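(* Assume all hypotheses of Theorem 1 as stated in the context (namely: $s>7$; (A0); (A1) with $\alpha=1$; (A3) with $\rho_c=0$, $\rho_n\ge0$, $L\rho_n\le\mu$; VFOG with $t_k=k+s+1$, estimators satisfying (EB) with $\frac{2s+1}{(s+1)^2}<\kappa\le1$, and $\frac{8(s-1)\rho_n}{3s-2}\le\eta<\frac{\lambda}{L}$, $(3s^2-8s-1)\eta>8(s-1)(s-2)\rho_n$, $\gamma_k=\frac{\eta(k+s)}{(s-2)(k+s+1)}$, $\beta_k=[\frac{(s-2)\eta}{4(s-1)}+2\rho_n]\frac{k+1}{k+s+1}-\frac{\gamma_k}{k+s+1}$), and assume $\sum_{k=0}^\infty\delta_k<\infty$. Then: (a) $\sum_{k=0}^\infty(k+1)\|Gx^k+v^k\|^2<\infty$ and $\sum_{k=0}^\infty(k+s)\|Gy^{k-1}+v^k\|^2<\infty$ almost surely; (b) almost surely $\lim_{k\to\infty}k^2\|Gx^k+v^k\|^2=0$ and $\lim_{k\to\infty}k^2\|Gy^{k-1}+v^k\|^2=0$; (c) if in addition $\mathrm{gra}\,\Phi$ is closed, then $\{x^k\}$ converges almost surely to a $\mathrm{zer}\,\Phi$-valued random variable $x^\star$, and $\{y^k\}$ and $\{z^k\}$ converge almost surely to the same $x^\star$.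
   Context: Problem setting: $G:\mathbb R^p\to\mathbb R^p$ is single-valued, $T:\mathbb R^p\rightrightarrows\mathbb R^p$ is set-valued, $\Phi:=G+T$, $\mathrm{gra}\,\Phi:=\{(x,w):w\in Gx+Tx\}$, $\mathrm{zer}\,\Phi:=\{x:0\in Gx+Tx\}\neq\emptyset$. $J_{\eta T}:=(I+\eta T)^{-1}$. $G$ is accessed through a stochastic oracle: a random variable $\xi$ and maps $\mathbf G_\xi:\mathbb R^p\to\mathbb R^p$ with $\mathbb E_\xi[\mathbf G_\xi x]=Gx$ for all $x$. Assumptions. (A0) there is $\sigma\ge0$ with $\mathbb E_\xi\|\mathbf G_\xi x-Gx\|^2\le\sigma^2$ for all $x$. (A1) there are $L>0$, $\alpha\in[0,1]$ with $\alpha\|Gx-Gy\|^2+(1-\alpha)\mathbb E_\xi\|\mathbf G_\xi x-\mathbf G_\xi y\|^2\le L^2\|x-y\|^2$ for all $x,y$. (A3) there are $\rho_n\ge\rho_c\ge0$ with $\langle w_x-w_y,x-y\rangle\ge-\rho_n\|w_x-w_y\|^2+\rho_c\,\mathbb E_\xi\|\mathbf G_\xi x-\mathbf G_\xi y\|^2$ for all $(x,w_x),(y,w_y)\in\mathrm{gra}\,\Phi$. Algorithm VFOG (parameters $s>0$, $\eta>0$, $t_k$, $\beta_k$, $\gamma_k$): choose $x^0$, $v^0\in Tx^0$, set $z^0:=x^0$, $y^{-1}:=x^0$, $\widetilde Gy^{-1}:=Gx^0$. For $k\ge0$: $\hat x^k:=\frac{t_k-s}{t_k}x^k+\frac{s}{t_k}z^k$;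 $y^k:=\hat x^k-(\eta-\beta_k)(\widetilde Gy^{k-1}+v^k)$; form an estimator $\widetilde Gy^k$ of $Gy^k$; then $x^{k+1}:=J_{\eta T}\big(\hat x^k-\eta\widetilde Gy^k+\beta_k(\widetilde Gy^{k-1}+v^k)\big)$ and $v^{k+1}:=\frac1\eta\big(\hat x^k-x^{k+1}+\beta_k(\widetilde Gy^{k-1}+v^k)\big)-\widetilde Gy^k\in Tx^{k+1}$; and $z^{k+1}:=z^k-\frac{\gamma_k}{s}(\widetilde Gy^{k-1}+v^k)$. $\mathcal F_k$ is the $\sigma$-algebra generated by all randomness up to iteration $k$, $\mathbb E_k[\cdot]:=\mathbb E[\cdot\mid\mathcal F_k]$. $e^k:=\widetilde Gy^k-Gy^k$ ($e^{-1}=0$). Error condition (EB): there are $\kappa\in(0,1]$, $\Theta\ge0$, nonnegative numbers $\delta_k$ and nonnegative random variables $\Delta_k$ ($\Delta_{-1}:=0$) such that almost surely for all $k\ge0$: $\mathbb E_k\|e^k\|^2\le\mathbb E_k\Delta_k$ and $\mathbb E_k\Delta_k\le(1-\kappa)\Delta_{k-1}+\Theta L^2\|x^k-y^{k-1}\|^2+\delta_k/t_k^2$. Constants: $\Lambda_0:=\frac{s^2(16s-18)}{(s-2)[s^2-(1-\kappa)(s+1)^2]}$, $\omega:=1+\frac{2(11s-13)}{s-2}+\frac{2\Lambda_0\Theta(s+1)^2}{s^2}$, $\mu:=\frac{3s-2}{8(s-1)\sqrt{2(1+\omega)(s+1)}}$, $\lambda:=\frac{1}{\sqrt{2(1+\omega)(s+1)}}$.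 *)

(* Defs.v *)
From HB Require Import structures.
From mathcomp Require Import all_boot all_order all_algebra.
From mathcomp Require Import all_classical all_reals all_analysis.
Set Implicit Arguments. Unset Strict Implicit. Unset Printing Implicit Defensive.
Import Order.TTheory GRing.Theory Num.Theory.
Import numFieldNormedType.Exports.
Local Open Scope classical_set_scope.
Local Open Scope ring_scope.

Definition dotv (R : realType) (p : nat) (u w : 'rV[R]_p) : R :=
  \sum_(i < p) u ord0 i * w ord0 i.

Definition nrm2 (R : realType) (p : nat) (u : 'rV[R]_p) : R := dotv u u.

Definition graPhi (R : realType) (p : nat) (G : 'rV[R]_p -> 'rV[R]_p)
  (T : 'rV[R]_p -> set 'rV[R]_p) (x w : 'rV[R]_p) : Prop :=
  exists2 t, T x t & w = G x + t.

Definition zerPhi (R : realType) (p : nat) (G : 'rV[R]_p -> 'rV[R]_p)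
  (T : 'rV[R]_p -> set 'rV[R]_p) (x : 'rV[R]_p) : Prop := graPhi G T x 0.

Definition Fmeas (Omega : Type) (R : realType) (F : set (set Omega))
  (f : Omega -> R) : Prop :=
  forall B : set R, measurable B -> F (f @^-1` B).

Definition FmeasV (Omega : Type) (R : realType) (p : nat)
  (F : set (set Omega)) (f : Omega -> 'rV[R]_p) : Prop :=
  forall i : 'I_p, Fmeas F (fun w => f w ord0 i).

(** Conditional-expectation inequality  E[X | F] <= E[Y | F]  a.s., for
    nonnegative X, Y, expressed through the defining property of the
    (generalized) conditional expectation: for every A in F,
    int_A X dP <= int_A Y dP. *)
Definition cond_le (d : measure_display) (Omega : measurableType d)
  (R : realType) (P : probability Omega R) (F : set (set Omega))
  (X Y : Omega -> \bar R) : Prop :=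
  forall A, F A -> (\int[P]_(w in A) X w <= \int[P]_(w in A) Y w)%E.

Definition Lambda0 (R : realType) (s kappa : R) : R :=
  s ^+ 2 * (16 * s - 18) /
  ((s - 2) * (s ^+ 2 - (1 - kappa) * (s + 1) ^+ 2)).

Definition omegaC (R : realType) (s kappa Theta : R) : R :=
  1 + 2 * (11 * s - 13) / (s - 2)
    + 2 * Lambda0 s kappa * Theta * (s + 1) ^+ 2 / s ^+ 2.

Definition muC (R : realType) (s kappa Theta : R) : R :=
  (3 * s - 2) /
  (8 * (s - 1) * Num.sqrt (2 * (1 + omegaC s kappa Theta) * (s + 1))).

Definition lambdaC (R : realType) (s kappa Theta : R) : R :=
  1 / Num.sqrt (2 * (1 + omegaC s kappa Theta) * (s + 1)).

Definition tk (R : realType) (s : R) (k : nat) : R := k%:R + s + 1.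

Definition gammak (R : realType) (s eta : R) (k : nat) : R :=
  eta * (k%:R + s) / ((s - 2) * (k%:R + s + 1)).

Definition betak (R : realType) (s eta rho_n : R) (k : nat) : R :=
  ((s - 2) * eta / (4 * (s - 1)) + 2 * rho_n) * (k%:R + 1) / (k%:R + s + 1)
  - gammak s eta k / (k%:R + s + 1).

Definition xhat (R : realType) (p : nat) (s : R) (k : nat) (x z : 'rV[R]_p) :
  'rV[R]_p := ((tk s k - s) / tk s k) *: x + (s / tk s k) *: z.

(* Main.v *)
(* Write w^k = G x^k + v^k and use the Lyapunov function
   a_k |w^k|^2 + s t_(k-1) <w^k, x^k - z^k> + c |z^k - x*|^2.  Weak monotonicity
   along x^(k+1) - x^k makes it decrease by a multiple of (k+1)|w^k|^2 and of
   t_k^2 |w^(k+1) - w^k|^2, up to errors t_k^2 |tilde G y^k - G x^(k+1)|^2 and a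
   factor 1 + C / t_k^2; for large k the errors are absorbed by the decrease and
   by the contraction in (EB).  As the errors only enter through their squares,
   total expectations suffice: they show that (k+1)|w^k|^2, t_k^2 |e^k|^2 and
   t_k^2 |x^(k+1) - y^k|^2 are summable almost surely, and everything else is a
   deterministic statement about one trajectory.  There x^k - z^k obeys a
   recursion with contraction factor 1 - s / t_k, hence tends to 0 and is square
   summable against 1 / t_k.  Then |z^k - x*|^2 converges for every zero x*, and
   the first two terms of the Lyapunov function, completed by a multiple of
   |x^k - z^k|^2, converge and are summable against 1 / t_k, so they tend to 0.
   Closedness of the graph makes every cluster point of x^k a zero, and
   convergence of |z^k - x*|^2 makes it the limit. *)
Require Import Defs.
From HB Require Import structures.
From mathcomp Require Import all_boot all_order all_algebra.
From mathcomp Require Import all_classical all_reals all_analysis.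
From mathcomp Require Import measurable_realfun ring lra.
Import Order.TTheory GRing.Theory Num.Theory.
Import numFieldNormedType.Exports.
Local Open Scope classical_set_scope.
Local Open Scope ring_scope.

(** * Inner products and row vectors *)

Section InnerProduct.
Context {R : realType} {p : nat}.
Implicit Types (a b : R) (u v w x y : 'rV[R]_p).

(** Two obstacles shape the argument. The descent holds only once [19 * s <= k%:R + 1], so that
    [t_k / (k + 1)] is at most [20 / 19]. Summability ignores the earlier indices, but the means at
    the starting index must be finite, which is not among the hypotheses. A cruder estimate, valid
    at every index, therefore first proves all iterates square integrable. Next, the Lyapunov
    function depends on a zero [x*], while there may be uncountably many zeros and the limit is not
    known in advance. The three summability statements drawn from the means do not mention [x*]:
    they fix one event of full probability, on which the convergence of [|z^k - x*|^2] is a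
    deterministic fact for every zero. No exceptional set depends on the zero, so a cluster point
    found on a path may itself serve as [x*]. Finally, the Lyapunov function alone only bounds
    [k^2 |w^k|^2], since its anchor term has no reason to vanish; a second energy without anchor
    gives the limit [0]. *)

Lemma dotvC u v : dotv u v = dotv v u.
Proof. by apply: eq_bigr => i _; rewrite mulrC. Qed.

Lemma dotvDl u v w : dotv (u + v) w = dotv u w + dotv v w.
Proof. by rewrite /dotv -big_split; apply: eq_bigr => i _; rewrite mxE mulrDl. Qed.

Lemma dotvZl a u v : dotv (a *: u) v = a * dotv u v.
Proof. by rewrite /dotv mulr_sumr; apply: eq_bigr => i _; rewrite mxE mulrA. Qed.

Lemma dotvDr u v w : dotv u (v + w) = dotv u v + dotv u w.
Proof. by rewrite dotvC dotvDl !(dotvC u). Qed.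

Lemma dotvZr a u v : dotv u (a *: v) = a * dotv u v.
Proof. by rewrite dotvC dotvZl dotvC. Qed.

Lemma dotvNl u v : dotv (- u) v = - dotv u v.
Proof. by rewrite -scaleN1r dotvZl mulN1r. Qed.

Lemma dotvNr u v : dotv u (- v) = - dotv u v.
Proof. by rewrite -scaleN1r dotvZr mulN1r. Qed.

Definition dotvE := (dotvDl, dotvDr, dotvNl, dotvNr, dotvZl, dotvZr).

Lemma nrm2_ge0 u : 0 <= nrm2 u.
Proof. by apply: sumr_ge0 => i _; rewrite -expr2 sqr_ge0. Qed.

Lemma nrm2N u : nrm2 (- u) = nrm2 u.
Proof. by rewrite /nrm2 !dotvE opprK. Qed.

Lemma nrm2Z a u : nrm2 (a *: u) = a ^+ 2 * nrm2 u.
Proof. by rewrite /nrm2 !dotvE mulrA. Qed.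

Lemma nrm2B u v : nrm2 (u - v) = nrm2 (v - u).
Proof. by rewrite -nrm2N opprB. Qed.

Lemma dotv_young a u v : 0 < a -> dotv u v <= a * nrm2 u + nrm2 v / (4 * a).
Proof.
move=> a0; have := nrm2_ge0 ((2 * a) *: u - v).
rewrite /nrm2 !dotvE (dotvC v u) => h.
have -> : dotv v v / (4 * a) = dotv v v * a^-1 / 4 by field; lra.
have : 0 <= (4 * a)^-1 * (2 * a * (2 * a * dotv u u) - 2 * a * dotv u v
   + (- (2 * a * dotv u v) - - dotv v v)).
  by apply: mulr_ge0; [rewrite invr_ge0; lra | apply: le_trans h _; lra].
have -> : (4 * a)^-1 * (2 * a * (2 * a * dotv u u) - 2 * a * dotv u v
   + (- (2 * a * dotv u v) - - dotv v v)) =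
   a * dotv u u - dotv u v + dotv v v * a^-1 / 4 by field; lra.
lra.
Qed.

Lemma dotv_youngN a u v :
  0 < a -> - dotv u v <= a * nrm2 u + nrm2 v / (4 * a).
Proof. by move=> /(dotv_young a u (- v)); rewrite dotvNr nrm2N. Qed.

Lemma nrm2D_le u v : nrm2 (u + v) <= 2 * nrm2 u + 2 * nrm2 v.
Proof.
have := nrm2_ge0 (u - v); rewrite /nrm2 !dotvE (dotvC v u); lra.
Qed.

Lemma nrm2B_le u v : nrm2 (u - v) <= 2 * nrm2 u + 2 * nrm2 v.
Proof. by have := nrm2D_le u (- v); rewrite nrm2N. Qed.

Lemma nrm2_subZ a u v :
  nrm2 (u - a *: v) = nrm2 u - 2 * a * dotv v u + a ^+ 2 * nrm2 v.
Proof. by rewrite /nrm2 !dotvE (dotvC u v); ring. Qed.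

(** Convexity of the square: the vector is the combination of [u] and [a^-1 *: v] with weights
    [1 - a] and [a]. *)
Lemma nrm2_relax a u v : 0 < a -> a <= 1 ->
  nrm2 ((1 - a) *: u + v) + a * nrm2 u <= nrm2 u + a^-1 * nrm2 v.
Proof.
move=> a0 a1; have a2 : 0 < a / 2 by rewrite divr_gt0.
have := dotv_young _ u v a2.
have -> : nrm2 v / (4 * (a / 2)) = a^-1 * nrm2 v / 2 by field; rewrite gt_eqF.
move=> h; have {h} : 2 * (1 - a) * dotv u v <=
    2 * (1 - a) * (a / 2 * nrm2 u + a^-1 * nrm2 v / 2).
  by apply: ler_wpM2l => //; lra.
have : a * (a^-1 * nrm2 v) = nrm2 v by rewrite mulrA divff ?mul1r// gt_eqF.
have -> : nrm2 ((1 - a) *: u + v) =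
    (1 - a) ^+ 2 * nrm2 u + 2 * (1 - a) * dotv u v + nrm2 v.
  by rewrite /nrm2 !dotvE (dotvC v u); ring.
lra.
Qed.

End InnerProduct.

(** * The one-step Lyapunov inequality *)

Section OneStep.
Context {R : realType} {p : nat}.
Implicit Types (w e r u : 'rV[R]_p).

(* At iterate [k] the argument [T] is [t_(k-1) = k + s], [w] is the residual
   [G x^k + v^k] and [r] is the gap [x^k - z^k]. *)
Definition energy (s eta B T : R) w r : R :=
  T * (T * ((eta - B) / 2) + s * ((eta + B) / 2)) * nrm2 w + s * T * dotv w r.

(* The energy drop is exactly [m t] times the weak monotonicity of the residual
   along the increment [u = x^(k+1) - x^k]; [e] and [e'] are the errors in the
   residuals the algorithm actually uses. *)
Lemma energy_step (s eta B rho gam m t : R) w w' e e' r r' u :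
  t = m + s -> 0 < m -> 0 < s ->
  u = - (s / t) *: r - eta *: (w' + e') + ((m * B - gam) / t) *: (w + e) ->
  r' = r + u + (gam / s) *: (w + e) ->
  - rho * nrm2 (w' - w) <= dotv (w' - w) u ->
  energy s eta B t w' r'
  + ((B + eta) / 2 - rho) * (m * t) * nrm2 (w' - w)
  + (((s - 1) * (eta - B) - gam) * m + (s - 1) * (s * eta - (eta - B) / 2))
    * nrm2 w
  + s * (s - 1) * dotv w r
  + t ^+ 2 * eta * dotv (w' - w) e' + s * t * eta * dotv w e'
  - t * m * B * dotv (w' - w) e - m * (s * B + gam) * dotv w e
  <= energy s eta B (t - 1) w r.
Proof.
move=> tE m0 s0 uE r'E mono.
have t0 : 0 < t by lra.
rewrite -subr_ge0.
pose X := m * t * (dotv (w' - w) u + rho * nrm2 (w' - w)).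
have X0 : 0 <= X by rewrite mulr_ge0 ?mulr_ge0//; lra.
apply: le_trans X0 _; rewrite le_eqVlt; apply/orP; left; apply/eqP.
rewrite /X /energy r'E uE /nrm2 !dotvE (dotvC w' w).
rewrite tE; field; lra.
Qed.

End OneStep.

(** [B] stands for the constant with [beta_k t_k = (k + 1) B - gamma_k]. [adm_gap] bounds below the
    coefficient of [nrm2 (w' - w)] in [energy_step]; [adm_drop] keeps the coefficient of
    [m * nrm2 w] positive after [gam] has taken up to [eta / (s - 2)] of it. *)
Record admissible {R : realType} (s eta B rho : R) : Prop := Admissible {
  adm_s : 7 < s;
  adm_eta : 0 < eta;
  adm_B : 0 <= B;
  adm_rho : 0 <= rho;
  adm_B_eta : B <= eta;
  adm_rho_eta : 2 * rho <= eta;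
  adm_gap : 3 / 5 * eta <= (B + eta) / 2 - rho;
  adm_drop : 5 / 4 * eta <= (s - 1) * (s - 2) * (eta - B) }.

(** * The Lyapunov function, with each contribution to its decrease bounded separately *)

Section Lyapunov.
Context {R : realType} {p : nat}.
Implicit Types (w e r u zeta : 'rV[R]_p) (m t T : R).
Variables (s eta B rho : R).

(** The anchor weight [c] solves [2 * c * gam / s = s * (s - 1)] for the limit value
    [gam = eta / (s - 2)]. The anchor step then cancels, up to a factor [1 / t], the term
    [s * (s - 1) * dotv w zeta] that monotonicity exchanges for [- s * (s - 1) * dotv w r]. *)
Definition lyap T w r zeta : R :=
  energy s eta B T w r + s ^+ 2 * (s - 1) * (s - 2) / (2 * eta) * nrm2 zeta.

(** Weak monotonicity at the zero trades [dotv w r] for [- dotv w zeta - rho * nrm2 w]. The [rho]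
    part is covered by [s * (eta + B) / 2], and Young at weight [9 / 20] leaves one twentieth of
    each square; [81 / 100 * 5 / 4 >= 1] is what lets [adm_drop] close it. *)
Lemma lyap_lower T w r zeta : admissible s eta B rho -> 0 < T ->
  - rho * nrm2 w <= dotv w (r + zeta) ->
  (eta - B) / 20 * (T ^+ 2 * nrm2 w)
  + s ^+ 2 * (s - 1) * (s - 2) / (20 * eta) * nrm2 zeta <= lyap T w r zeta.
Proof.
case=> s7 eta0 B0 rho0 Beta rho_eta gap drop T0; rewrite dotvDr => mono.
have d0 : 0 < eta - B.
  have : 0 < (s - 1) * (s - 2) * (eta - B) by lra.
  by rewrite pmulr_rgt0//; apply: mulr_gt0; lra.
have ss0 : 0 < (s - 1) * (s - 2) by apply: mulr_gt0; lra.
have a0 : 0 < 9 / 20 * (eta - B) by lra.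
have := dotv_young _ (T *: w) (s *: zeta) a0.
rewrite !nrm2Z dotvZl dotvZr => young.
have zc : s ^+ 2 * nrm2 zeta / (4 * (9 / 20 * (eta - B))) <=
    9 / 20 * (s ^+ 2 * (s - 1) * (s - 2) / eta * nrm2 zeta).
  rewrite ler_pdivrMr; last lra.
  have -> : 9 / 20 * (s ^+ 2 * (s - 1) * (s - 2) / eta * nrm2 zeta) *
      (4 * (9 / 20 * (eta - B))) = s ^+ 2 * nrm2 zeta *
      (81 / 100 * ((s - 1) * (s - 2) * (eta - B)) / eta) by field; lra.
  rewrite -[leLHS]mulr1; apply: ler_wpM2l.
    by rewrite mulr_ge0 ?nrm2_ge0 ?sqr_ge0.
  rewrite ler_pdivlMr//; lra.
have k0 : 0 <= s * T * ((B + eta) / 2 - rho) * nrm2 w.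
  rewrite mulr_ge0 ?nrm2_ge0// mulr_ge0 ?mulr_ge0//; lra.
have sT : 0 < s * T by apply: mulr_gt0; lra.
have : s * T * (- rho * nrm2 w) <= s * T * (dotv w r + dotv w zeta).
  by rewrite ler_pM2l.
have c0 : 0 <= s ^+ 2 * (s - 1) * (s - 2) / eta * nrm2 zeta.
  rewrite mulr_ge0 ?nrm2_ge0// divr_ge0 ?ltW// -mulrA mulr_gt0 ?exprn_gt0//; lra.
have -> : s ^+ 2 * (s - 1) * (s - 2) / (20 * eta) * nrm2 zeta =
  (s ^+ 2 * (s - 1) * (s - 2) / eta * nrm2 zeta) / 20 by field; lra.
rewrite /lyap /energy.
have -> : s ^+ 2 * (s - 1) * (s - 2) / (2 * eta) * nrm2 zeta =
  (s ^+ 2 * (s - 1) * (s - 2) / eta * nrm2 zeta) / 2 by field; lra.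
move: zc c0; set c := s ^+ 2 * (s - 1) * (s - 2) / eta * nrm2 zeta.
lra.
Qed.

Definition gam (t : R) : R := eta * (t - 1) / ((s - 2) * t).

Lemma gam_bound t : admissible s eta B rho -> 1 <= t ->
  [/\ 0 <= gam t, gam t <= eta / (s - 2) & gam t <= eta].
Proof.
case=> s7 eta0 _ _ _ _ _ _ t1.
have s20 : 0 < s - 2 by lra.
have t0 : 0 < t by lra.
have g0 : 0 <= gam t.
  rewrite /gam divr_ge0//; first by apply: mulr_ge0; lra.
  by rewrite mulr_ge0// ltW.
have gle : gam t <= eta / (s - 2).
  rewrite /gam ler_pdivrMr; last by rewrite mulr_gt0.
  have -> : eta / (s - 2) * ((s - 2) * t) = eta * t by field; lra.
  by rewrite ler_pM2l//; lra.
split=> //; apply: le_trans gle _; rewrite ler_pdivrMr// ler_peMr//; lra.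
Qed.

(* Young's inequality absorbs the cross terms of [energy_step] into the
   [3 / 5] gap: what is left is written with [w' + e' - (w + e)]. *)
Lemma increment_step m t w w' e e' :
  admissible s eta B rho -> 19 * s <= m -> t = m + s ->
  eta * t ^+ 2 / 10 * nrm2 (w' + e' - (w + e))
  - t ^+ 2 * eta * dotv (w' - w) e' + t * m * B * dotv (w' - w) e
  <= ((B + eta) / 2 - rho) * (m * t) * nrm2 (w' - w)
     + t ^+ 2 * eta * (9 / 5 * nrm2 e + 9 / 5 * nrm2 e').
Proof.
case=> s7 eta0 B0 rho0 Beta rho_eta gap _ m19 tE.
have m0 : 0 <= m by lra.
have t0 : 0 <= t by lra.
have mt : 19 / 20 * t <= m by lra.
have m_t : m <= t by lra.
have e0 : 0 <= eta by lra.
have k0 : 0 <= 3 / 5 * eta by lra.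
have t190 : 0 <= 19 / 20 * t by lra.
have t2e : 0 <= t ^+ 2 * eta by rewrite mulr_ge0 ?sqr_ge0.
clear s7 eta0 rho_eta m19 tE rho0.
have E0 := nrm2_ge0 e; have E'0 := nrm2_ge0 e'; have D0 := nrm2_ge0 (w' - w).
(* Since [m >= 19 / 20 * t], the available [3 / 5] is worth [57 / 100]. Two Young terms take
   [36 / 100], and [1 / 5] goes to the difference kept on the left. Each error costs
   [1 / (4 * 0.18) + 4 / 10 < 9 / 5]. *)
have t18 : 18 / 100 > 0 :> R by lra.
have T1 : t ^+ 2 * eta * - dotv (w' - w) e' <= t ^+ 2 * eta *
    (18 / 100 * nrm2 (w' - w) + nrm2 e' / (4 * (18 / 100))).
  by rewrite ler_wpM2l//; exact: dotv_youngN.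
have T2 : t * m * B * dotv (w' - w) e <= t ^+ 2 * eta *
    (18 / 100 * nrm2 (w' - w) + nrm2 e / (4 * (18 / 100))).
  apply: le_trans
    (_ : t * m * B * (18 / 100 * nrm2 (w' - w) + nrm2 e / (4 * (18 / 100))) <= _).
    by rewrite ler_wpM2l ?mulr_ge0//; exact: dotv_young.
  rewrite ler_wpM2r//; first lra.
  by rewrite expr2 ler_pM// ?ler_pM// ?mulr_ge0.
have M3 : 57 / 100 * (t ^+ 2 * eta) * nrm2 (w' - w) <=
    ((B + eta) / 2 - rho) * (m * t) * nrm2 (w' - w).
  rewrite ler_wpM2r//.
  have -> : 57 / 100 * (t ^+ 2 * eta) = (3 / 5 * eta) * (19 / 20 * t * t) by field.
  by rewrite ler_pM// ?ler_wpM2r ?mulr_ge0.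
have D1 : nrm2 (w' + e' - (w + e)) <= 2 * nrm2 (w' - w) + 4 * nrm2 e' + 4 * nrm2 e.
  have -> : w' + e' - (w + e) = (w' - w) + (e' - e) by rewrite opprD addrACA.
  have := nrm2D_le (w' - w) (e' - e); have := nrm2B_le e' e.
  clear - p s eta B rho; lra.
have D2 : eta * t ^+ 2 / 10 * nrm2 (w' + e' - (w + e)) <=
  eta * t ^+ 2 / 10 * (2 * nrm2 (w' - w) + 4 * nrm2 e' + 4 * nrm2 e).
  by rewrite ler_wpM2l// divr_ge0// mulrC.
have P0 : 0 <= t ^+ 2 * eta * nrm2 (w' - w) by rewrite mulr_ge0.
have P1 : 0 <= t ^+ 2 * eta * nrm2 e by rewrite mulr_ge0.
have P2 : 0 <= t ^+ 2 * eta * nrm2 e' by rewrite mulr_ge0.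
move: T1 T2 M3 D2 P0 P1 P2; clear - p s eta B rho; lra.
Qed.

(** Pairing an error with [w] itself costs [nrm2 w] without any factor [t]. As the Lyapunov function
    controls [T ^+ 2 * nrm2 w], this is a relative perturbation of order [1 / t ^+ 2]. *)
Lemma cross_step m t w e e' :
  admissible s eta B rho -> 0 <= m -> t = m + s ->
  - (s * t * eta * dotv w e') + m * (s * B + gam t) * dotv w e <=
  eta * ((5 * s ^+ 2 + 5 * (s + 1) ^+ 2) * nrm2 w
    + t ^+ 2 / 20 * (nrm2 e + nrm2 e')).
Proof.
move=> adm m0 tE; have := adm; case=> s7 eta0 B0 _ Beta _ _ _.
have [|g0 _ g1] := gam_bound t adm; first lra.
have W0 := nrm2_ge0 w; have E0 := nrm2_ge0 e.
have s0 : 0 <= s by lra.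
have t0 : 0 <= t by lra.
have m_t : m <= t by lra.
have h1 : ((s * B + gam t) / eta) ^+ 2 <= (s + 1) ^+ 2.
  have q0 : 0 <= s * B + gam t by rewrite addr_ge0// mulr_ge0.
  rewrite ler_pXn2r ?nnegrE ?addr_ge0//.
    by rewrite ler_pdivrMr// mulrDl mul1r lerD// ler_wpM2l.
  by rewrite divr_ge0// ltW.
have h2 : m ^+ 2 <= t ^+ 2 by rewrite ler_pXn2r ?nnegrE.
have {h1}h1 := ler_wpM2r W0 h1; have {h2}h2 := ler_wpM2r E0 h2.
have eN0 : eta != 0 by rewrite gt_eqF.
have e0 : 0 <= eta by rewrite ltW.
have t5 : 5 > 0 :> R by [].
have T3 : - (s * t * eta * dotv w e') <=
    eta * (5 * s ^+ 2 * nrm2 w + t ^+ 2 * nrm2 e' / 20).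
  have := dotv_youngN _ (s *: w) (t *: e') t5.
  rewrite dotvZl dotvZr !nrm2Z => h.
  have -> : - (s * t * eta * dotv w e') = eta * (- (s * (t * dotv w e'))) by ring.
  by rewrite ler_wpM2l//; move: h; clear - p s eta B rho; lra.
have T4 : m * (s * B + gam t) * dotv w e <=
    eta * (5 * (s + 1) ^+ 2 * nrm2 w + t ^+ 2 * nrm2 e / 20).
  have := dotv_young _ (((s * B + gam t) / eta) *: w) (m *: e) t5.
  rewrite dotvZl dotvZr !nrm2Z => h.
  have -> : m * (s * B + gam t) * dotv w e =
    eta * ((s * B + gam t) / eta * (m * dotv w e)) by field.
  by rewrite ler_wpM2l//; move: h h1 h2; clear - p s eta B rho; lra.
by move: T3 T4; clear - p s eta B rho; lra.
Qed.

(** What survives the cancellation built into the anchor weight is split by Young so that [zeta]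
    always carries [1 / t ^+ 2], a summable factor. *)
Lemma anchor_step t w e zeta :
  admissible s eta B rho -> 100 <= t ->
  s ^+ 2 * (s - 1) * (s - 2) / (2 * eta) *
    nrm2 (zeta - (gam t / s) *: (w + e)) + s * (s - 1) * dotv w zeta
  <= s ^+ 2 * (s - 1) * (s - 2) / (2 * eta) * nrm2 zeta
   + eta * (3 * nrm2 w + t ^+ 2 * (nrm2 e / 10))
   + 6 * s ^+ 2 * (s - 1) ^+ 2 / (eta * t ^+ 2) * nrm2 zeta.
Proof.
move=> adm t100; have := adm; case=> s7 eta0 _ _ _ _ _ _.
have [|g0 gle _] := gam_bound t adm; first lra.
have W0 := nrm2_ge0 w; have E0 := nrm2_ge0 e; have Z0 := nrm2_ge0 zeta.
have s_neq0 : s != 0 by rewrite gt_eqF//; lra.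
have s1_gt0 : 0 < s - 1 by lra.
have s2_gt0 : 0 < s - 2 by lra.
have s_gt6 : 1 * (s - 1) <= 6 / 5 * (s - 2) by lra.
have t_gt0 : 0 < t by lra.
have t_neq0 : t != 0 by rewrite gt_eqF.
have s2_neq0 : s - 2 != 0 by rewrite gt_eqF.
have eN0 : eta != 0 by rewrite gt_eqF.
have e0 : 0 <= eta by rewrite ltW.
clear adm s7.
set c := s ^+ 2 * (s - 1) * (s - 2) / (2 * eta).
set K := (s * (s - 1) / t) ^+ 2 * nrm2 zeta / eta.
have K0 : 0 <= K by rewrite /K divr_ge0// mulr_ge0// sqr_ge0.
have -> : 6 * s ^+ 2 * (s - 1) ^+ 2 / (eta * t ^+ 2) * nrm2 zeta = 6 * K.
  by rewrite /K; field; rewrite ?t_neq0 ?eN0.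
have -> : c * nrm2 (zeta - (gam t / s) *: (w + e)) = c * nrm2 zeta
    - s * (s - 1) * dotv w zeta - s * (s - 1) * dotv e zeta
    + s * (s - 1) / t * dotv w zeta + s * (s - 1) / t * dotv e zeta
    + c * (gam t / s) ^+ 2 * nrm2 (w + e).
  rewrite /c /gam /nrm2 !dotvE (dotvC zeta w) (dotvC zeta e) (dotvC e w).
  by field; rewrite ?s2_neq0 ?s_neq0 ?t_neq0 ?eN0.
have cg : c * (gam t / s) ^+ 2 <= eta.
  have -> : c * (gam t / s) ^+ 2 = (s - 1) * (s - 2) / (2 * eta) * (gam t * gam t).
    by rewrite /c; field; rewrite ?s_neq0 ?eN0.
  apply: (@le_trans _ _ ((s - 1) * (s - 2) / (2 * eta) * (eta / (s - 2) * (eta / (s - 2))))).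
    apply: ler_wpM2l; last by rewrite ler_pM.
    by rewrite divr_ge0// mulr_ge0 ?(ltW s1_gt0) ?(ltW s2_gt0).
  have -> : (s - 1) * (s - 2) / (2 * eta) * (eta / (s - 2) * (eta / (s - 2))) =
     eta * ((s - 1) / (2 * (s - 2))) by field; rewrite ?s2_neq0 ?eN0.
  rewrite -[leRHS]mulr1 ler_pM2l// ler_pdivrMr ?mulr_gt0//.
  by move: s_gt6 s2_gt0; clear - p s eta B rho; lra.
have T8 : c * (gam t / s) ^+ 2 * nrm2 (w + e) <= eta * (2 * nrm2 w + 2 * nrm2 e).
  apply: ler_pM; [|exact: nrm2_ge0|exact: cg|exact: nrm2D_le].
  apply: mulr_ge0; last exact: sqr_ge0.
  apply: divr_ge0; last by rewrite mulr_ge0.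
  by apply: mulr_ge0 (ltW s2_gt0); apply: mulr_ge0 (ltW s1_gt0); exact: sqr_ge0.
have y5 : 0 < eta / 20 by rewrite divr_gt0.
have T5 : - (s * (s - 1) * dotv e zeta) <= eta / 20 * (t ^+ 2 * nrm2 e) + 5 * K.
  have := dotv_youngN _ (t *: e) ((s * (s - 1) / t) *: zeta) y5.
  rewrite dotvZl dotvZr !nrm2Z.
  have -> : t * (s * (s - 1) / t * dotv e zeta) = s * (s - 1) * dotv e zeta.
    by field; rewrite ?t_neq0 ?eN0 ?s2_neq0.
  have -> : (s * (s - 1) / t) ^+ 2 * nrm2 zeta / (4 * (eta / 20)) = 5 * K.
    by rewrite /K; field; rewrite ?t_neq0 ?eN0.
  by [].
have Y v : s * (s - 1) / t * dotv v zeta <= eta * nrm2 v + K / 4.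
  have := dotv_young _ v ((s * (s - 1) / t) *: zeta) eta0.
  rewrite dotvZr !nrm2Z.
  have -> : (s * (s - 1) / t) ^+ 2 * nrm2 zeta / (4 * eta) = K / 4.
    by rewrite /K; field; rewrite ?t_neq0 ?eN0.
  by [].
have T6 := Y w; have T7 := Y e.
have D4 : 100 * (eta * nrm2 e) <= eta * (t ^+ 2 * nrm2 e).
  rewrite mulrCA ler_wpM2l// ler_wpM2r// expr2 -[leLHS]mulr1 ler_pM//; last first.
    by apply: le_trans t100; rewrite ler1n.
clearbody c K.
have D5 : 0 <= eta * nrm2 e by rewrite mulr_ge0.
by move: T5 T6 T7 T8 D4 D5 K0; clear - p s eta B rho; lra.
Qed.

(** The [rho] term on the left is the price of applying weak monotonicity at a zero with weight
    [s * (s - 1)]; the bounded part of the coefficient pays for it, and [adm_drop] supplies the part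
    growing with [m]. *)
Lemma weight_step m t w :
  admissible s eta B rho -> 0 <= m -> 1 <= t ->
  eta / (4 * (s - 2)) * m * nrm2 w + s * (s - 1) * rho * nrm2 w <=
  (((s - 1) * (eta - B) - gam t) * m + (s - 1) * (s * eta - (eta - B) / 2))
    * nrm2 w.
Proof.
move=> adm m0 t1; have := adm; case=> s7 eta0 B0 rho0 Beta rho_eta _ drop.
have [_ gle _] := gam_bound t adm t1.
rewrite -mulrDl; apply: ler_wpM2r; first exact: nrm2_ge0.
have s1_gt0 : 0 < s - 1 by lra.
have s2_gt0 : 0 < s - 2 by lra.
have s2_neq0 : s - 2 != 0 by rewrite gt_eqF.
apply: lerD.
  apply: ler_wpM2r => //.
  apply: (@le_trans _ _ ((s - 1) * (eta - B) - eta / (s - 2))); last first.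
    by move: gle; clear - p s eta B rho; lra.
  rewrite -(@ler_pM2l _ (s - 2))//.
  have -> : (s - 2) * (eta / (4 * (s - 2))) = eta / 4 by field.
  have -> : (s - 2) * ((s - 1) * (eta - B) - eta / (s - 2)) =
    (s - 1) * (s - 2) * (eta - B) - eta by field.
  by move: drop; clear - p s eta B rho; lra.
have -> : s * (s - 1) * rho = (s - 1) * (s * rho) by ring.
rewrite ler_pM2l//.
have h1 : s * (2 * rho) <= s * eta by rewrite ler_pM2l//; lra.
have h2 : 1 * eta <= s * eta by rewrite ler_pM2r//; lra.
by move: h1 h2 B0; clear - p s eta B rho; lra.
Qed.

(** The partial bounds charge [9 / 5 + 1 / 20 + 1 / 10 < 2] to the old error. Adding the same term
    at the next index on the left makes these charges telescope, at the cost of raising the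
    coefficient of the new error to at most [5]. *)
Lemma lyap_step m t w w' e e' r r' u zeta :
  admissible s eta B rho -> 19 * s <= m -> t = m + s ->
  u = - (s / t) *: r - eta *: (w' + e') + ((m * B - gam t) / t) *: (w + e) ->
  r' = r + u + (gam t / s) *: (w + e) ->
  - rho * nrm2 (w' - w) <= dotv (w' - w) u ->
  - rho * nrm2 w <= dotv w (r + zeta) ->
  lyap t w' r' (zeta - (gam t / s) *: (w + e)) + 2 * eta * (t + 1) ^+ 2 * nrm2 e'
  + eta * t ^+ 2 / 10 * nrm2 (w' + e' - (w + e))
  + eta / (4 * (s - 2)) * m * nrm2 w
  <= lyap (t - 1) w r zeta + 2 * eta * t ^+ 2 * nrm2 e
   + 5 * eta * t ^+ 2 * nrm2 e'
   + eta * (5 * s ^+ 2 + 5 * (s + 1) ^+ 2 + 3) * nrm2 w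
   + 6 * s ^+ 2 * (s - 1) ^+ 2 / (eta * t ^+ 2) * nrm2 zeta.
Proof.
move=> adm m19 tE uE r'E mono1 mono0.
have := adm; case=> s7 eta0 _ _ _ _ _ _.
have m0 : 0 < m by lra.
have s0 : 0 < s by lra.
have ss : 0 < s * (s - 1) by rewrite mulr_gt0//; lra.
have t100 : 100 <= t by lra.
have t1 : 1 <= t by lra.
have e0 : 0 <= eta by rewrite ltW.
have step := energy_step s eta B rho (gam t) m t _ _ _ _ _ _ _ tE m0 s0 uE r'E mono1.
have I := increment_step m t w w' e e' adm m19 tE.
have C := cross_step m t w e e' adm (ltW m0) tE.
have A := anchor_step t w e zeta adm t100.
have W := weight_step m t w adm (ltW m0) t1.
have M : s * (s - 1) * (- rho * nrm2 w) <= s * (s - 1) * (dotv w r + dotv w zeta).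
  by rewrite ler_pM2l// -dotvDr.
have t1E : (t + 1) ^+ 2 <= 103 / 100 * t ^+ 2.
  have tt : 100 * t <= t ^+ 2 by rewrite expr2 ler_wpM2r//; lra.
  have -> : (t + 1) ^+ 2 = t ^+ 2 + 2 * t + 1 by ring.
  lra.
have D3 : 2 * eta * (t + 1) ^+ 2 * nrm2 e' <= 2 * eta * (103 / 100 * t ^+ 2) * nrm2 e'.
  by rewrite ler_wpM2r ?nrm2_ge0// ler_wpM2l// mulr_ge0.
have pe : 0 <= eta * (t ^+ 2 * nrm2 e).
  by rewrite mulr_ge0// mulr_ge0 ?sqr_ge0 ?nrm2_ge0.
have pe' : 0 <= eta * (t ^+ 2 * nrm2 e').
  by rewrite mulr_ge0// mulr_ge0 ?sqr_ge0 ?nrm2_ge0.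
rewrite /lyap.
move: step I C A W M D3 pe pe'; clear - p s eta B rho.
set en1 := energy _ _ _ _ _ _; set en0 := energy _ _ _ _ _ _.
set z1 := s ^+ 2 * (s - 1) * (s - 2) / (2 * eta) * nrm2 (zeta - _).
set z0 := s ^+ 2 * (s - 1) * (s - 2) / (2 * eta) * nrm2 zeta.
set K := 6 * s ^+ 2 * (s - 1) ^+ 2 / (eta * t ^+ 2) * nrm2 zeta.
set k1 := ((B + eta) / 2 - rho) * (m * t) * nrm2 (w' - w).
set D := nrm2 (w' + e' - (w + e)).
set g := gam t.
set g1 := eta / (4 * (s - 2)) * m.
lra.
Qed.

End Lyapunov.

(** * Almost decreasing real sequences *)

Section RealSequences.
Context {R : realType}.
Implicit Types (u a b d : nat -> R).

Lemma cvg_series_ge u : (forall k, 0 <= u k) -> cvgn (series u) ->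
  exists M, forall n, series u n <= M.
Proof.
move=> u0 cu; exists (limn (series u)) => n.
by apply: nondecreasing_cvgn_le => //; apply: nondecreasing_series.
Qed.

Lemma is_cvg_seriesM u (C : R) :
  cvgn (series u) -> cvgn (series (fun k => C * u k)).
Proof.
have -> : series (fun k => C * u k) = cst C \* series u.
  by apply/funext => n; rewrite /series/= mulr_sumr.
by move=> cu; apply: is_cvgM => //; exact: is_cvg_cst.
Qed.

Lemma is_cvg_series_add u d : cvgn (series u) -> cvgn (series d) ->
  cvgn (series (fun k => u k + d k)).
Proof. exact: is_cvg_seriesD. Qed.

Lemma series_dominated u d (C : R) : (forall k, 0 <= u k) ->
  (forall k, u k <= C * d k) -> cvgn (series d) -> cvgn (series u).
Proof.
move=> u0 ud cd; apply: (series_le_cvg u0 (v_ := fun k => C * d k)) => //.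
  by move=> n; exact: le_trans (ud n).
exact: is_cvg_seriesM.
Qed.

Lemma is_cvg_series_shift u N :
  cvgn (series (fun k => u (k + N)%N)) = cvgn (series u).
Proof.
rewrite -[RHS](is_cvg_series_restrict N).
have E : series (fun k => u (k + N)%N) =
    [sequence (fun n => \sum_(N <= k < n) u k) (n + N)%N]_n.
  apply/funext => n /=.
  by rewrite [RHS](_ : _ = \sum_(0 + N <= k < n + N) u k)// big_addn addnK.
rewrite E propeqE; split=> /cvg_ex[l ul]; apply/cvg_ex; exists l.
  by have <- := cvg_shiftn N (fun n => \sum_(N <= k < n) u k) (nbhs l).
by have -> := cvg_shiftn N (fun n => \sum_(N <= k < n) u k) (nbhs l).
Qed.

Lemma descent_cvg u a d (M : R) : (forall k, M <= u k) -> (forall k, 0 <= a k) ->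
  (forall k, 0 <= d k) ->
  (forall k, u k.+1 + a k <= u k + d k) -> cvgn (series d) ->
  cvgn u /\ cvgn (series a).
Proof.
move=> Mu a0 d0 step cd.
have [D dD] := cvg_series_ge _ d0 cd.
have sa n : series a n <= u 0%N - u n + series d n.
  elim: n => [|n ih]; first by rewrite /series /= !big_nil; lra.
  by rewrite !seriesSr; have := step n; lra.
split; last first.
  apply: nondecreasing_is_cvgn; first exact: nondecreasing_series.
  exists (u 0%N - M + D) => _ [n _ <-].
  by have := sa n; have := dD n; have := Mu n; lra.
have -> : u = (fun n => u n - series d n) \+ series d.
  by apply/funext => n /=; rewrite subrK.
apply: is_cvgD => //; apply: nonincreasing_is_cvgn.
  apply/nonincreasing_seqP => n; rewrite seriesSr.
  by have := step n; have := a0 n; lra.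
exists (M - D) => _ [n _ <-].
by have := Mu n; have := dD n; lra.
Qed.

(** A deterministic Robbins-Siegmund statement: the product of the factors [1 + b k] is at most an
    exponential of the series, so [u] is bounded, and [b k * u k] joins the summable perturbation of
    [descent_cvg]. *)
Lemma fejer_cvg u a b d : (forall k, 0 <= u k) -> (forall k, 0 <= a k) ->
  (forall k, 0 <= b k) -> (forall k, 0 <= d k) ->
  (forall k, u k.+1 + a k <= (1 + b k) * u k + d k) ->
  cvgn (series b) -> cvgn (series d) ->
  cvgn u /\ cvgn (series a).
Proof.
move=> u0 a0 b0 d0 step cb cd.
have [D dD] := cvg_series_ge _ d0 cd; have [E bE] := cvg_series_ge _ b0 cb.
have D0 : 0 <= D by apply: le_trans (dD 0%N); rewrite /series /= big_nil.
have grow n : u n <= (u 0%N + series d n) * expR (series b n).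
  elim: n => [|n ih]; first by rewrite /series /= !big_nil expR0 addr0 mulr1.
  rewrite !seriesSr expRD.
  apply: (@le_trans _ _ ((1 + b n) * u n + d n)).
    by have := step n; have := a0 n; lra.
  have b1 : 1 + b n <= expR (b n) by exact: expR_ge1Dx.
  have S0 : 0 <= series b n by apply: sumr_ge0.
  have e1 : 1 <= expR (series b n) * expR (b n).
    by rewrite -expRD -expR0 ler_expR addr_ge0.
  have -> : (u 0%N + (series d n + d n)) * (expR (series b n) * expR (b n)) =
    expR (b n) * ((u 0%N + series d n) * expR (series b n)) +
    d n * (expR (series b n) * expR (b n)) by ring.
  apply: lerD; last by rewrite ler_peMr.
  apply: ler_pM => //; first by rewrite addr_ge0.
pose C := (u 0%N + D) * expR E.
have uC n : u n <= C.
  apply: le_trans (grow n) _; apply: ler_pM; rewrite ?expR_ge0 ?ler_expR//.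
    by rewrite addr_ge0// sumr_ge0.
  by rewrite lerD2l.
apply: (@descent_cvg u a (fun k => C * b k + d k) 0) => // [k|k|].
- by rewrite addr_ge0// mulr_ge0// (le_trans (u0 0%N)).
- apply: le_trans (step k) _; rewrite mulrDl mul1r -addrA lerD2l lerD2r mulrC.
  exact: ler_wpM2r.
- exact: (is_cvg_seriesD (is_cvg_seriesM _ C cb) cd).
Qed.

Lemma tk_gt0 (s : R) k : 0 < s -> 0 < tk s k.
Proof. by move=> s0; rewrite /tk addr_gt0// ltr_wpDl. Qed.

Lemma series_inv_sqr_tk (s : R) : 0 < s ->
  cvgn (series (fun k => (tk s k ^+ 2)^-1)).
Proof.
move=> s0.
have t0 k : 0 < k%:R + s by rewrite ltr_wpDl.
(* Comparison by telescoping: [(k%:R + s)^-1] drops by more than the k-th term. *)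
have [] // := @descent_cvg (fun k => (k%:R + s)^-1)
  (fun k => (tk s k ^+ 2)^-1) (fun=> 0) 0.
- by move=> k; rewrite invr_ge0 ltW.
- by move=> k; rewrite invr_ge0 sqr_ge0.
- move=> k; rewrite addr0 -natr1 /tk; have := t0 k; set T := k%:R + s => T0.
  have -> : k%:R + 1 + s = T + 1 by rewrite /T; ring.
  rewrite -subr_ge0.
  have -> : T^-1 - ((T + 1)^-1 + ((T + 1) ^+ 2)^-1) = (T * (T + 1) ^+ 2)^-1.
    by field; lra.
  by rewrite invr_ge0 mulr_ge0 ?sqr_ge0// ltW.
- have -> : series (fun=> 0 : R) = cst 0.
    by apply/funext => n; rewrite /series /= big1.
  exact: is_cvg_cst.
Qed.

(** A positive limit would make the series dominate a multiple of the harmonic one. *)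
Lemma cvg0_of_series_div_tk (s : R) u : 0 < s -> (forall k, 0 <= u k) ->
  cvgn u -> cvgn (series (fun k => u k / tk s k)) -> u @ \oo --> 0.
Proof.
move=> s0 u0 cu cs; set l := limn u.
have l0 : 0 <= l by apply: limr_ge => //; near=> n.
suff : l = 0 by move=> <-.
apply/eqP/negP => /negP l_neq0.
have {l_neq0}l_gt0 : 0 < l by rewrite lt_neqAle eq_sym l_neq0.
have /cvgrPdist_lt/(_ (l / 2)) [|N _ uN] := cu; first by rewrite divr_gt0.
apply: (@dvg_harmonic R).
rewrite -(is_cvg_series_shift _ N).
move: cs; rewrite -(is_cvg_series_shift (fun k => u k / tk s k) N) => cs.
apply: (@series_dominated _ _ (2 * (s + 1) / l) _ _ cs) => k.
  by rewrite invr_ge0.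
have {uN} : l / 2 <= u (k + N)%N.
  have /= := uN (k + N)%N (leq_addl _ _).
  rewrite -/l; have := ler_norm (l - u (k + N)%N); lra.
have := tk_gt0 s (k + N) s0; rewrite /tk /harmonic /=.
set n := (k + N)%N; have n0 : 0 <= n%:R :> R by [].
move=> t0 ul; rewrite -[n.+1%:R]natr1.
have -> : (n%:R + 1)^-1 = 2 * (s + 1) / l * (l / 2 / ((s + 1) * (n%:R + 1))).
  by field; lra.
apply: ler_wpM2l; first by rewrite divr_ge0 ?mulr_ge0//; lra.
apply: ler_pM => //; first lra.
  by rewrite invr_ge0 mulr_ge0; lra.
rewrite lef_pV2 ?posrE//; last by rewrite mulr_gt0; lra.
have : 0 <= s * n%:R by rewrite mulr_ge0// ltW.
lra.
Unshelve. all: by end_near. Qed.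

End RealSequences.

(** * Topology of row vectors *)

Section RowTopology.
Context {R : realType} {p : nat}.
Implicit Types (u l : 'rV[R]_p).

Lemma sqr_coord_le u i : u ord0 i ^+ 2 <= nrm2 u.
Proof.
rewrite /nrm2 /dotv (bigD1 i)//= expr2 lerDl sumr_ge0// => j _.
by rewrite -expr2 sqr_ge0.
Qed.

Lemma nbhs_nrm2 l (e : R) : 0 < e -> nbhs l [set u | nrm2 (u - l) < e].
Proof.
(* With [d <= 1] each squared coordinate is at most [d]; [p + 1] in place of [p] makes the final
   inequality strict and covers [p = 0]. *)
move=> e0; pose d := Num.min 1 (e / (p%:R + 1)).
have p0 : 0 <= p%:R :> R by [].
have d0 : 0 < d by rewrite lt_min ltr01 divr_gt0//; lra.
have d1 : d <= 1 by rewrite ge_min lexx.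
have de : d * (p%:R + 1) <= e.
  rewrite -ler_pdivlMr; last lra.
  by rewrite ge_min lexx orbT.
apply/nbhs_ballP; exists d => //= u lu.
have : nrm2 (u - l) <= \sum_(i < p) d.
  apply: ler_sum => i _; rewrite !mxE.
  have [_ /(_ ord0 i)] := lu; rewrite -ball_normE /= => /ltW.
  rewrite distrC => ui.
  rewrite -expr2 -real_normK ?num_real// expr2.
  apply: (@le_trans _ _ (d * 1)); last by rewrite mulr1.
  by apply: ler_pM => //; exact: le_trans ui d1.
rewrite sumr_const card_ord -mulr_natr /= => h.
by apply: le_lt_trans h _; lra.
Qed.

Lemma cvg_of_nrm2 (f : nat -> 'rV[R]_p) l :
  (fun k => nrm2 (f k - l)) @ \oo --> 0 -> f @ \oo --> l.
Proof.
move=> fl; apply/cvg_ballP => e e0.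
have e2 : 0 < e ^+ 2 by rewrite exprn_gt0.
near=> k; split=> // i j; rewrite ord1 -ball_normE /=.
have : nrm2 (f k - l) < e ^+ 2 by near: k; exact: (cvgr_lt 0 fl).
have := sqr_coord_le (f k - l) j; rewrite !mxE => h1 h2.
rewrite distrC -(@ltr_pXn2r _ 2)// ?nnegrE ?(ltW e0)// real_normK ?num_real//.
exact: le_lt_trans h2.
Unshelve. all: by end_near. Qed.

Lemma nrm2_bounded_cluster (f : nat -> 'rV[R]_p) M :
  (forall k, nrm2 (f k) <= M) -> exists l, cluster (f @ \oo) l.
Proof.
move=> fM; have M0 : 0 <= M := le_trans (nrm2_ge0 _) (fM 0%N).
have K : compact [set u : 'rV[R]_p | forall i, `[- (M + 1), M + 1]%classic (u ord0 i)].
  by have := @rV_compact R p (fun=> `[- (M + 1), M + 1]%classic)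
    (fun=> @segment_compact _ _ _).
have [|l [_ cl]] := K (f @ \oo) _; last by exists l.
exists 0%N => // k _ i /=; rewrite in_itv/= -ler_norml.
have h := le_trans (sqr_coord_le (f k) i) (fM k).
rewrite -(@ler_pXn2r _ 2)// ?nnegrE ?addr_ge0// real_normK ?num_real//.
by apply: le_trans h _; have := sqr_ge0 M; lra.
Qed.

Lemma cvg_seq_bounded_le {f : nat -> R} :
  cvgn f -> exists M, forall k, f k <= M.
Proof.
move=> /cvg_seq_bounded[N [_ fN]]; exists (N + 1) => k.
by apply: le_trans (ler_norm _) (fN (N + 1) _ k I); rewrite ltrDl.
Qed.

End RowTopology.

(** * Trajectories of the algorithm *)

(** [wm_mono] is co-hypomonotonicity of [G + T] over all pairs of its graph; with a zero as second
    point it becomes the weak Minty inequality. *)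
Record weak_minty_data {R : realType} {p : nat} (G : 'rV[R]_p -> 'rV[R]_p)
    (T : 'rV[R]_p -> set 'rV[R]_p) (L rho : R) : Prop := WeakMintyData {
  wm_lip : forall y y', nrm2 (G y - G y') <= L ^+ 2 * nrm2 (y - y');
  wm_mono : forall y wy y' wy', graPhi G T y wy -> graPhi G T y' wy' ->
    - rho * nrm2 (wy - wy') <= dotv (wy - wy') (y - y') }.

(** The resolvent appears only through its graph: [path_T] and [path_v] together say that [x k.+1]
    is a resolvent value, [v k.+1] being the selected element of [T]. The entries [ym k] and [Gm k]
    belong to [y^(k-1)]. *)
Record vfog_path {R : realType} {p : nat} (T : 'rV[R]_p -> set 'rV[R]_p)
    (s eta rho : R) (x v z ym Gm : nat -> 'rV[R]_p) : Prop := VfogPath {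
  path_T : forall k, T (x k) (v k);
  path_y : forall k, ym k.+1 = xhat s k (x k) (z k)
    - (eta - betak s eta rho k) *: (Gm k + v k);
  path_v : forall k, v k.+1 = eta^-1 *: (xhat s k (x k) (z k) - x k.+1
    + betak s eta rho k *: (Gm k + v k)) - Gm k.+1;
  path_z : forall k, z k.+1 = z k - (gammak s eta k / s) *: (Gm k + v k) }.

Section Path.
Context {R : realType} {p : nat}.
Variables (G : 'rV[R]_p -> 'rV[R]_p) (T : 'rV[R]_p -> set 'rV[R]_p).
Variables (L rho s eta : R) (x v z ym Gm : nat -> 'rV[R]_p).

(* [beta_k t_k = (k + 1) Bc - gamma_k]. *)
Definition Bc : R := (s - 2) * eta / (4 * (s - 1)) + 2 * rho.

Lemma betakE k : betak s eta rho k =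
  ((k%:R + 1) * Bc - gam s eta (tk s k)) / tk s k.
Proof.
rewrite /betak /Bc /gammak /gam /tk.
have -> : k%:R + s + 1 - 1 = k%:R + s by ring.
by rewrite [RHS]mulrBl [(k%:R + 1) * _]mulrC.
Qed.

Lemma gammakE k : gammak s eta k = gam s eta (tk s k).
Proof. by rewrite /gammak /gam /tk addrK. Qed.

Definition resid k : 'rV[R]_p := G (x k) + v k.
Definition shift_err k : 'rV[R]_p := Gm k - G (x k).
(* The index is the lagged one: this is [e^(k-1)]. *)
Definition est_err k : 'rV[R]_p := Gm k - G (ym k).

Definition lyapk (xs : 'rV[R]_p) k : R :=
  lyap s eta Bc (k%:R + s) (resid k) (x k - z k) (z k - xs).

Lemma resid_shift k : resid k + shift_err k = Gm k + v k.
Proof. by rewrite /resid /shift_err addrC addrA subrK. Qed.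

Hypothesis adm : admissible s eta Bc rho.
Hypothesis ops : weak_minty_data G T L rho.
Hypothesis run : vfog_path T s eta rho x v z ym Gm.

Lemma graPhi_resid k : graPhi G T (x k) (resid k).
Proof. by exists (v k) => //; exact: path_T run k. Qed.

Lemma path_x k : x k.+1 = xhat s k (x k) (z k)
  + betak s eta rho k *: (Gm k + v k) - eta *: (resid k.+1 + shift_err k.+1).
Proof.
have eta0 := adm_eta _ _ _ _ adm.
have := path_v _ _ _ _ _ _ _ _ _ run k.
rewrite resid_shift => /(congr1 (fun q => eta *: (Gm k.+1 + q))) -> /=.
rewrite [Gm k.+1 + _]addrC subrK scalerA divff ?gt_eqF// scale1r.
by apply/rowP => i; rewrite !mxE; ring.
Qed.

Lemma path_incr k : x k.+1 - x k = - (s / tk s k) *: (x k - z k)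
  - eta *: (resid k.+1 + shift_err k.+1)
  + (((k%:R + 1) * Bc - gam s eta (tk s k)) / tk s k) *: (resid k + shift_err k).
Proof.
rewrite path_x betakE /xhat resid_shift.
have := adm_s _ _ _ _ adm => s7.
have t0 : tk s k != 0 by rewrite gt_eqF// tk_gt0//; lra.
by apply/rowP => i; rewrite !mxE; field.
Qed.

Lemma path_r k : x k.+1 - z k.+1 = (x k - z k) + (x k.+1 - x k)
  + (gam s eta (tk s k) / s) *: (resid k + shift_err k).
Proof.
rewrite (path_z _ _ _ _ _ _ _ _ _ run) gammakE resid_shift.
by apply/rowP => i; rewrite !mxE; ring.
Qed.

Lemma path_zeta (xs : 'rV[R]_p) k : z k.+1 - xs =
  (z k - xs) - (gam s eta (tk s k) / s) *: (resid k + shift_err k).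
Proof.
rewrite (path_z _ _ _ _ _ _ _ _ _ run) gammakE resid_shift.
by apply/rowP => i; rewrite !mxE; ring.
Qed.

(** This is why the descent keeps the square of [w' + e' - (w + e)]: up to [eta ^+ 2] it is the lag,
    which (EB) charges at the next step. *)
Lemma path_lag k : x k.+1 - ym k.+1 =
  - eta *: (resid k.+1 + shift_err k.+1 - (resid k + shift_err k)).
Proof.
rewrite path_x (path_y _ _ _ _ _ _ _ _ _ run) (resid_shift k).
by apply/rowP => i; rewrite !mxE; ring.
Qed.

Lemma resid_mono k : - rho * nrm2 (resid k.+1 - resid k) <=
  dotv (resid k.+1 - resid k) (x k.+1 - x k).
Proof. by apply: (wm_mono _ _ _ _ ops); exact: graPhi_resid. Qed.

Lemma resid_zer (xs : 'rV[R]_p) k : zerPhi G T xs ->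
  - rho * nrm2 (resid k) <= dotv (resid k) (x k - xs).
Proof.
move=> zx; have := wm_mono _ _ _ _ ops _ _ _ _ (graPhi_resid k) zx.
by rewrite subr0.
Qed.

Lemma shift_err_le k :
  nrm2 (shift_err k) <= 2 * nrm2 (est_err k) + 2 * L ^+ 2 * nrm2 (x k - ym k).
Proof.
have -> : shift_err k = est_err k - (G (x k) - G (ym k)).
  by rewrite /shift_err /est_err; apply/rowP => i; rewrite !mxE; ring.
apply: le_trans (nrm2B_le _ _) _.
by rewrite lerD2l -mulrA ler_pM2l//; exact: wm_lip ops _ _.
Qed.

(** Ratio of the two perturbations in [lyap_step] to the two squares in [lyapk_lower]:
    [80 = 4 * 20], with [4] from [tk s k <= 2 * (k%:R + s)], and [120 = 6 * 20]. *)
Definition gronwall_const : R :=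
  80 * eta * (5 * s ^+ 2 + 5 * (s + 1) ^+ 2 + 3) / (eta - Bc)
  + 120 * (s - 1) / (s - 2).

Lemma admissible_gap : 0 < eta - Bc.
Proof.
case: adm => s7 eta0 _ _ _ _ _ drop.
have ss : 0 < (s - 1) * (s - 2) by apply: mulr_gt0; lra.
have : 0 < (s - 1) * (s - 2) * (eta - Bc) by lra.
by rewrite pmulr_rgt0.
Qed.

Lemma gronwall_const_ge0 : 0 <= gronwall_const.
Proof.
have gap0 := admissible_gap.
have [s7 eta0] := (adm_s _ _ _ _ adm, adm_eta _ _ _ _ adm).
rewrite addr_ge0// divr_ge0 ?(ltW gap0)//; last first.
- lra.
- lra.
by rewrite !mulr_ge0// ?(ltW eta0)// !addr_ge0// mulr_ge0// sqr_ge0.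
Qed.

Lemma lyapk_lower (xs : 'rV[R]_p) k : zerPhi G T xs ->
  (eta - Bc) / 20 * ((k%:R + s) ^+ 2 * nrm2 (resid k))
  + s ^+ 2 * (s - 1) * (s - 2) / (20 * eta) * nrm2 (z k - xs) <= lyapk xs k.
Proof.
move=> zx; apply: (lyap_lower _ _ _ _ _ _ _ _ adm).
  by rewrite ltr_wpDl//; have := adm_s _ _ _ _ adm; lra.
by rewrite addrA subrK; exact: resid_zer.
Qed.

Lemma lyapk_ge0 (xs : 'rV[R]_p) k : zerPhi G T xs -> 0 <= lyapk xs k.
Proof.
move=> zx; apply: le_trans (lyapk_lower _ k zx).
have gap0 := admissible_gap.
have [s7 eta0] := (adm_s _ _ _ _ adm, adm_eta _ _ _ _ adm).
apply: addr_ge0; apply: mulr_ge0; rewrite ?nrm2_ge0//.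
- by rewrite divr_ge0// ltW.
- by rewrite mulr_ge0 ?sqr_ge0 ?nrm2_ge0.
- apply: divr_ge0; last lra.
  by apply: mulr_ge0; [apply: mulr_ge0; [exact: sqr_ge0|lra]|lra].
Qed.

(** The new shift error splits into the estimator error, left to (EB), and a multiple of the lag,
    absorbed by the lag term of the descent: hence [1 / 10 - 10 * (L * eta) ^+ 2]. *)
Lemma path_descent (xs : 'rV[R]_p) k : zerPhi G T xs -> 19 * s <= k%:R + 1 ->
  lyapk xs k.+1 + 2 * eta * tk s k.+1 ^+ 2 * nrm2 (shift_err k.+1)
  + (1 / 10 - 10 * (L * eta) ^+ 2) / eta * (tk s k ^+ 2 * nrm2 (x k.+1 - ym k.+1))
  + eta / (4 * (s - 2)) * ((k%:R + 1) * nrm2 (resid k))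
  <= (1 + gronwall_const / tk s k ^+ 2) * lyapk xs k
   + 2 * eta * tk s k ^+ 2 * nrm2 (shift_err k)
   + 10 * eta * tk s k ^+ 2 * nrm2 (est_err k.+1).
Proof.
move=> zx k19.
have gap0 := admissible_gap.
have [s7 eta0] := (adm_s _ _ _ _ adm, adm_eta _ _ _ _ adm).
have s10 : 0 < s - 1 by lra.
have s20 : 0 < s - 2 by lra.
have s0 : 0 < s by lra.
have t0 := tk_gt0 s k s0.
have tE : tk s k = k%:R + 1 + s by rewrite /tk; ring.
have tE1 : tk s k - 1 = k%:R + s by rewrite /tk; ring.
have tE2 : tk s k + 1 = tk s k.+1 by rewrite /tk -[k.+1%:R]natr1; ring.
have mono0 : - rho * nrm2 (resid k) <= dotv (resid k) ((x k - z k) + (z k - xs)).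
  by rewrite addrA subrK; exact: resid_zer.
have := lyap_step s eta Bc rho _ _ _ _ _ _ _ _ _ _ adm k19 tE (path_incr k)
  (path_r k) (resid_mono k) mono0.
rewrite -path_zeta tE1 tE2.
have -> : lyap s eta Bc (tk s k) (resid k.+1) (x k.+1 - z k.+1) (z k.+1 - xs) =
    lyapk xs k.+1.
  rewrite /lyapk; congr lyap; rewrite /tk -natr1; ring.
rewrite -/(lyapk xs k).
have lag := path_lag k.
have -> : nrm2 (x k.+1 - ym k.+1) = eta ^+ 2 *
  nrm2 (resid k.+1 + shift_err k.+1 - (resid k + shift_err k)).
  by rewrite lag nrm2Z sqrrN.
have := shift_err_le k.+1; rewrite lag nrm2Z sqrrN.
set D := nrm2 (resid k.+1 + _ - _).
have low := lyapk_lower xs k zx; have lyap0 := lyapk_ge0 xs k zx.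
move=> err step.
have err2 : 5 * eta * tk s k ^+ 2 * nrm2 (shift_err k.+1) <= 5 * eta * tk s k ^+ 2 *
    (2 * nrm2 (est_err k.+1) + 2 * L ^+ 2 * (eta ^+ 2 * D)).
  by rewrite ler_wpM2l// !mulr_ge0 ?sqr_ge0// ltW.
have D0 : 0 <= D by exact: nrm2_ge0.
have Z0 := nrm2_ge0 (z k - xs); have W0 := nrm2_ge0 (resid k).
have abs : eta * (5 * s ^+ 2 + 5 * (s + 1) ^+ 2 + 3) * nrm2 (resid k)
    + 6 * s ^+ 2 * (s - 1) ^+ 2 / (eta * tk s k ^+ 2) * nrm2 (z k - xs)
    <= gronwall_const / tk s k ^+ 2 * lyapk xs k.
  pose C1 := eta * (5 * s ^+ 2 + 5 * (s + 1) ^+ 2 + 3).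
  have C10 : 0 <= C1.
    by rewrite mulr_ge0 ?(ltW eta0)// !addr_ge0// mulr_ge0// sqr_ge0.
  have cE : gronwall_const = 80 * C1 / (eta - Bc) + 120 * (s - 1) / (s - 2).
    by rewrite /gronwall_const /C1; congr (_ / _ + _); ring.
  rewrite [leRHS]mulrAC ler_pdivlMr ?exprn_gt0//.
  have tT : tk s k ^+ 2 <= 4 * (k%:R + s) ^+ 2.
    have -> : 4 * (k%:R + s) ^+ 2 = (2 * (k%:R + s)) ^+ 2 by ring.
    rewrite ler_pXn2r ?nnegrE ?(ltW t0)//; rewrite /tk;
      have : 0 <= k%:R :> R by []; lra.
  have h1 : C1 * nrm2 (resid k) * tk s k ^+ 2 <=
     80 * C1 / (eta - Bc) * ((eta - Bc) / 20 * ((k%:R + s) ^+ 2 * nrm2 (resid k))).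
    have -> : 80 * C1 / (eta - Bc) * ((eta - Bc) / 20 * ((k%:R + s) ^+ 2 * nrm2 (resid k))) =
      C1 * nrm2 (resid k) * (4 * (k%:R + s) ^+ 2).
      by field; rewrite gt_eqF.
    by rewrite ler_wpM2l// mulr_ge0.
  have h2 : 6 * s ^+ 2 * (s - 1) ^+ 2 / (eta * tk s k ^+ 2) * nrm2 (z k - xs) * tk s k ^+ 2
     = 120 * (s - 1) / (s - 2) *
     (s ^+ 2 * (s - 1) * (s - 2) / (20 * eta) * nrm2 (z k - xs)).
    by field; rewrite !gt_eqF.
  rewrite mulrDl h2 -/C1.
  set k1 := 80 * C1 / (eta - Bc) in h1 cE *; set k2 := 120 * (s - 1) / (s - 2) in h2 cE *.
  set q1 := (eta - Bc) / 20 * _ in low h1 *.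
  set q2 := s ^+ 2 * (s - 1) * (s - 2) / (20 * eta) * _ in low h2 *.
  have k10 : 0 <= k1 by apply: divr_ge0 (ltW gap0); exact: mulr_ge0.
  have k20 : 0 <= k2 by apply: divr_ge0 (ltW s20); apply: mulr_ge0 (ltW s10).
  have q10 : 0 <= q1 by apply: mulr_ge0; [exact: divr_ge0 (ltW gap0) _|apply: mulr_ge0; rewrite ?sqr_ge0].
  have q20 : 0 <= q2.
    apply: mulr_ge0 => //; apply: divr_ge0; last by apply: mulr_ge0 (ltW eta0).
    by apply: mulr_ge0 (ltW s20); apply: mulr_ge0 (ltW s10); exact: sqr_ge0.
  apply: (@le_trans _ _ (gronwall_const * (q1 + q2))); last first.
    by apply: ler_wpM2l low; exact: gronwall_const_ge0.
  have := mulr_ge0 k10 q20; have := mulr_ge0 k20 q10.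
  by rewrite cE; move: h1; clear; lra.
have -> : (1 / 10 - 10 * (L * eta) ^+ 2) / eta * (tk s k ^+ 2 * (eta ^+ 2 * D)) =
  eta * tk s k ^+ 2 / 10 * D - 5 * eta * tk s k ^+ 2 * (2 * L ^+ 2 * (eta ^+ 2 * D)).
  by field; rewrite gt_eqF.
rewrite [(1 + _) * _]mulrDl mul1r.
move: step err2 abs.
set a1 := eta * (5 * s ^+ 2 + 5 * (s + 1) ^+ 2 + 3) * nrm2 (resid k).
set a2 := 6 * s ^+ 2 * (s - 1) ^+ 2 / (eta * tk s k ^+ 2) * nrm2 (z k - xs).
set a3 := gronwall_const / tk s k ^+ 2 * lyapk xs k.
set a4 := eta / (4 * (s - 2)).
clearbody D a1 a2 a3 a4.
lra.
Qed.

(* A bound on one step of the (implicit) resolvent update, crude but valid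
   from [k = 0] on: it gives the square integrability of the iterates. *)
Lemma path_crude (xs : 'rV[R]_p) k : zerPhi G T xs -> 16 * (L * eta) ^+ 2 <= 1 ->
  nrm2 (x k.+1 - xs) / 2 + eta ^+ 2 / 5 * nrm2 (resid k.+1) <=
  2 * nrm2 (xhat s k (x k) (z k) - xs + betak s eta rho k *: (Gm k + v k))
  + 4 * eta ^+ 2 * nrm2 (est_err k.+1) + nrm2 (ym k.+1 - xs).
Proof.
move=> zx q16; set U := xhat _ _ _ _ - _ + _.
case: adm => _ eta0 _ _ Beta _ gap _.
(* The squared norm of this identity is bounded on both sides. Its cross term costs at most
   [4 / 5 * eta ^+ 2 * nrm2 W], as [rho <= 2 / 5 * eta]; the shift error depends on the unknown
   [x k.+1], and [16 * (L * eta) ^+ 2 <= 1] lets half of [nrm2 a] absorb that. *)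
have aE : (x k.+1 - xs) + eta *: resid k.+1 = U - eta *: shift_err k.+1.
  by rewrite path_x /U; apply/rowP => i; rewrite !mxE; ring.
have mono := resid_zer xs k.+1 zx.
have E : x k.+1 - ym k.+1 = (x k.+1 - xs) - (ym k.+1 - xs).
  by apply/rowP => i; rewrite !mxE; ring.
have err := shift_err_le k.+1; rewrite E in err.
set a := x k.+1 - xs in aE mono err *; clearbody a.
set W := resid k.+1 in aE mono *; clearbody W.
have := nrm2B_le U (eta *: shift_err k.+1).
rewrite -aE nrm2Z {1}/nrm2 !dotvE (dotvC a) -/(nrm2 a) -/(nrm2 (W)).
have lag := nrm2B_le a (ym k.+1 - xs).
have X0 := nrm2_ge0 a; have Y0 := nrm2_ge0 (ym k.+1 - xs).
have W0 := nrm2_ge0 (W).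
have e2 : 0 <= eta ^+ 2 by exact: sqr_ge0.
have h1 : eta ^+ 2 * nrm2 (shift_err k.+1) <= eta ^+ 2 * (2 * nrm2 (est_err k.+1)
   + 2 * L ^+ 2 * (2 * nrm2 a + 2 * nrm2 (ym k.+1 - xs))).
  rewrite ler_wpM2l//; apply: le_trans err _; rewrite lerD2l ler_wpM2l//.
  by apply: mulr_ge0; rewrite ?sqr_ge0.
have h2 : 16 * (L * eta) ^+ 2 * (nrm2 a + nrm2 (ym k.+1 - xs)) <=
   1 * (nrm2 a + nrm2 (ym k.+1 - xs)).
  by rewrite ler_wpM2r// addr_ge0.
have h3 : eta * (- rho * nrm2 (W)) <= eta * dotv (W) a.
  by rewrite ler_pM2l.
have h4 : eta * rho * nrm2 (W) <= eta * (2 / 5 * eta) * nrm2 (W).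
  by rewrite ler_wpM2r// ler_pM2l//; lra.
move: h1 h2 h3 h4 Y0; clear; lra.
Qed.

End Path.

(** * Pathwise convergence *)

Section PathConvergence.
Context {R : realType} {p : nat}.
Variables (G : 'rV[R]_p -> 'rV[R]_p) (T : 'rV[R]_p -> set 'rV[R]_p).
Variables (L rho s eta : R) (x v z ym Gm : nat -> 'rV[R]_p).

Local Notation Bc := (Bc rho s eta).
Local Notation w := (resid G x v).
Local Notation ep := (shift_err G x Gm).
Local Notation en := (est_err G ym Gm).
Local Notation wt := (fun k => Gm k + v k).
Local Notation r := (fun k => x k - z k).

Hypothesis adm : admissible s eta Bc rho.
Hypothesis ops : weak_minty_data G T L rho.
Hypothesis run : vfog_path T s eta rho x v z ym Gm.
Hypothesis sum_w : cvgn (series (fun k => (k%:R + 1) * nrm2 (w k))).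
Hypothesis sum_en : cvgn (series (fun k => tk s k ^+ 2 * nrm2 (en k.+1))).
Hypothesis sum_lag :
  cvgn (series (fun k => tk s k ^+ 2 * nrm2 (x k.+1 - ym k.+1))).

Let s_gt7 : 7 < s. Proof. exact: adm_s adm. Qed.
Let s_gt0 : 0 < s. Proof. by have := s_gt7; lra. Qed.
Let eta_gt0 : 0 < eta. Proof. exact: adm_eta adm. Qed.

Let t_ge8 k : 8 <= tk s k.
Proof. by rewrite /tk; have := s_gt7; have : 0 <= k%:R :> R by []; lra. Qed.

Let tS k : tk s k.+1 = tk s k + 1.
Proof. by rewrite /tk -[k.+1%:R]natr1; ring. Qed.

Lemma series_sqr_tk_pred (f : nat -> R) : (forall k, 0 <= f k) ->
  cvgn (series (fun k => tk s k ^+ 2 * f k.+1)) ->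
  cvgn (series (fun k => tk s k ^+ 2 * f k)).
Proof.
move=> f0 cf; rewrite -(is_cvg_series_shift _ 1).
apply: (@series_dominated _ _ _ 4 _ _ cf) => k; rewrite addn1.
  by rewrite mulr_ge0 ?sqr_ge0.
rewrite mulrA ler_wpM2r// tS.
have -> : 4 * tk s k ^+ 2 = (2 * tk s k) ^+ 2 by ring.
by have := t_ge8 k => t8; rewrite ler_pXn2r ?nnegrE//; lra.
Qed.

Lemma sum_epS : cvgn (series (fun k => tk s k ^+ 2 * nrm2 (ep k.+1))).
Proof.
apply: (@series_dominated _ _ _ 1 _ _ (is_cvg_series_add _ _
  (is_cvg_seriesM _ 2 sum_en) (is_cvg_seriesM _ (2 * L ^+ 2) sum_lag))) => k.
  by rewrite mulr_ge0 ?sqr_ge0 ?nrm2_ge0.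
have := shift_err_le _ _ _ _ _ _ _ ops k.+1 => h.
have : tk s k ^+ 2 * nrm2 (ep k.+1) <= tk s k ^+ 2 *
    (2 * nrm2 (en k.+1) + 2 * L ^+ 2 * nrm2 (x k.+1 - ym k.+1)).
  by apply: ler_wpM2l; rewrite ?sqr_ge0.
by move/le_trans; apply; lra.
Qed.

Lemma sum_ep : cvgn (series (fun k => tk s k ^+ 2 * nrm2 (ep k))).
Proof. by apply: series_sqr_tk_pred sum_epS => k; exact: nrm2_ge0. Qed.

Lemma sum_en0 : cvgn (series (fun k => tk s k ^+ 2 * nrm2 (en k))).
Proof. by apply: series_sqr_tk_pred sum_en => k; exact: nrm2_ge0. Qed.

Lemma sum_tw : cvgn (series (fun k => tk s k * nrm2 (w k))).
Proof.
apply: (@series_dominated _ _ _ (s + 1) _ _ sum_w) => k.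
  by rewrite mulr_ge0 ?nrm2_ge0//; have := t_ge8 k; lra.
rewrite mulrA ler_wpM2r ?nrm2_ge0// /tk.
have : 0 <= s * k%:R by rewrite mulr_ge0// ltW.
lra.
Qed.

Lemma sum_twt : cvgn (series (fun k => tk s k * nrm2 (wt k))).
Proof.
apply: (@series_dominated _ _ _ 2 _ _ (is_cvg_series_add _ _ sum_tw sum_ep)) => k /=.
  by rewrite mulr_ge0 ?nrm2_ge0//; have := t_ge8 k; lra.
rewrite -(resid_shift G x v Gm).
have t8 := t_ge8 k; have e0 := nrm2_ge0 (ep k).
have h1 : tk s k * nrm2 (w k + ep k) <= tk s k * (2 * nrm2 (w k) + 2 * nrm2 (ep k)).
  by rewrite ler_wpM2l ?nrm2D_le//; lra.
have h2 : 1 * (tk s k * nrm2 (ep k)) <= tk s k * (tk s k * nrm2 (ep k)).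
  by rewrite ler_wpM2r ?mulr_ge0//; lra.
by move: h1 h2; lra.
Qed.

Lemma sum_lagged_resid :
  cvgn (series (fun k => (k%:R + s) * nrm2 (G (ym k) + v k))).
Proof.
apply: (@series_dominated _ _ _ 2 _ _ (is_cvg_series_add _ _ sum_twt sum_en0)) => k /=.
  by rewrite mulr_ge0 ?nrm2_ge0// addr_ge0// ltW.
have -> : G (ym k) + v k = wt k - en k.
  by rewrite /est_err; apply/rowP => i; rewrite !mxE; ring.
have t8 := t_ge8 k; have e0 := nrm2_ge0 (en k).
have h1 : (k%:R + s) * nrm2 (wt k - en k) <= tk s k * (2 * nrm2 (wt k) + 2 * nrm2 (en k)).
  rewrite ler_pM ?nrm2B_le ?nrm2_ge0 ?addr_ge0 ?(ltW s_gt0)//.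
  by rewrite /tk lerDl.
have h2 : 1 * (tk s k * nrm2 (en k)) <= tk s k * (tk s k * nrm2 (en k)).
  by rewrite ler_wpM2r ?mulr_ge0//; lra.
by move: h1 h2; lra.
Qed.

(* The gap [x k - z k] contracts by the factor [1 - s / t_k], so it is driven
   to [0] by residuals that are summable against [t_k]. *)
Definition gap_drive k : R :=
  (tk s k / s) * (2 * eta ^+ 2 * nrm2 (wt k.+1) + 8 * eta ^+ 2 * nrm2 (wt k)).

Lemma gap_drive_ge0 k : 0 <= gap_drive k.
Proof.
apply: mulr_ge0; first by rewrite divr_ge0 ?(ltW s_gt0)//; have := t_ge8 k; lra.
have e2 : 0 <= eta ^+ 2 by exact: sqr_ge0.
by apply: addr_ge0; apply: mulr_ge0 (nrm2_ge0 _); exact: mulr_ge0.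
Qed.

Lemma gap_step k :
  nrm2 (r k.+1) + s * (nrm2 (r k) / tk s k) <= nrm2 (r k) + gap_drive k.
Proof.
have t8 := t_ge8 k; have t0 : tk s k != 0 by rewrite gt_eqF//; lra.
have sN0 : s != 0 by rewrite gt_eqF.
set b := ((k%:R + 1) * Bc - gam s eta (tk s k)) / tk s k + gam s eta (tk s k) / s.
set g := - eta *: wt k.+1 + b *: wt k.
have -> : r k.+1 = (1 - s / tk s k) *: r k + g.
  rewrite (path_r G _ _ _ _ _ _ _ _ _ run) (path_incr G _ _ _ _ _ _ _ _ _ adm run).
  rewrite !resid_shift /g /b.
  by apply/rowP => i; rewrite !mxE; ring.
have b0 : 0 <= b /\ b <= 2 * eta.
  have [|g0 _ g1] := gam_bound _ _ _ _ (tk s k) adm; first lra.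
  have [_ _ B0 _ Beta _ _ _] := adm.
  have -> : b = (k%:R + 1) / tk s k * Bc + gam s eta (tk s k) * (s^-1 - (tk s k)^-1).
    by rewrite /b; ring.
  have k0 : 0 <= k%:R :> R by [].
  have kt : (k%:R + 1) / tk s k <= 1.
    by rewrite ler_pdivrMr; rewrite /tk; have := s_gt0; lra.
  have kt0 : 0 <= (k%:R + 1) / tk s k by rewrite divr_ge0//; lra.
  have d0 : 0 <= s^-1 - (tk s k)^-1.
    by rewrite subr_ge0 lef_pV2 ?posrE//; rewrite /tk; have := s_gt0; lra.
  have d1 : s^-1 - (tk s k)^-1 <= 1.
    have : s^-1 <= 1 by rewrite invf_le1//; have := s_gt7; lra.
    have : 0 <= (tk s k)^-1 by rewrite invr_ge0; lra.
    lra.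
  have q1 := ler_pM kt0 B0 kt Beta; have q2 := ler_pM g0 d0 g1 d1.
  split; first by apply: addr_ge0; exact: mulr_ge0.
  move: q1 q2; lra.
have gle : nrm2 g <= 2 * eta ^+ 2 * nrm2 (wt k.+1) + 8 * eta ^+ 2 * nrm2 (wt k).
  have nb : b ^+ 2 * nrm2 (wt k) <= (2 * eta) ^+ 2 * nrm2 (wt k).
    apply: ler_wpM2r; first exact: nrm2_ge0.
    by rewrite ler_pXn2r ?nnegrE//; have := eta_gt0; case: b0; lra.
  apply: le_trans (nrm2D_le _ _) _; rewrite !nrm2Z sqrrN.
  move: nb; lra.
have l0 : 0 < s / tk s k by rewrite divr_gt0//; lra.
have l1 : s / tk s k <= 1.
  by rewrite ler_pdivrMr; rewrite /tk; have : 0 <= k%:R :> R by []; have := s_gt0; lra.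
have dle : tk s k / s * nrm2 g <= gap_drive k.
  by rewrite /gap_drive ler_wpM2l// divr_ge0 ?(ltW s_gt0)//; lra.
apply: le_trans (lerD (lexx _) dle).
have -> : tk s k / s = (s / tk s k)^-1 by rewrite invf_div.
have -> : s * (nrm2 (r k) / tk s k) = s / tk s k * nrm2 (r k) by ring.
move: l0 l1; set l := s / tk s k => l0 l1.
exact: nrm2_relax.
Qed.

Lemma sum_gap_drive : cvgn (series gap_drive).
Proof.
pose f k := tk s k * nrm2 (wt k).
have cf : cvgn (series (fun k => f k.+1)).
  by have := sum_twt; rewrite -(is_cvg_series_shift _ 1);
     under eq_fun do rewrite addn1.
apply: (@series_dominated _ _ _ (8 * eta ^+ 2 / s) _ _
  (is_cvg_series_add _ _ cf sum_twt)) => k /=; first exact: gap_drive_ge0.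
rewrite /gap_drive /f tS.
have t8 := t_ge8 k; have W0 := nrm2_ge0 (wt k.+1).
have -> : tk s k / s * (2 * eta ^+ 2 * nrm2 (wt k.+1) + 8 * eta ^+ 2 * nrm2 (wt k)) =
  8 * eta ^+ 2 / s * (tk s k * (nrm2 (wt k.+1) / 4) + tk s k * nrm2 (wt k)).
  by field; rewrite gt_eqF.
apply: ler_wpM2l.
  by apply: divr_ge0 (ltW s_gt0); apply: mulr_ge0 => //; exact: sqr_ge0.
rewrite lerD2r.
have : tk s k * (nrm2 (wt k.+1) / 4) <= tk s k * nrm2 (wt k.+1).
  by rewrite ler_wpM2l//; lra.
lra.
Qed.

Lemma gap_cvg : cvgn (fun k => nrm2 (r k)) /\
  cvgn (series (fun k => nrm2 (r k) / tk s k)).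
Proof.
have a0 k : 0 <= nrm2 (r k) / tk s k.
  by rewrite divr_ge0 ?nrm2_ge0//; have := t_ge8 k; lra.
have [|c1 c2] := descent_cvg (fun k => nrm2 (r k))
  (fun k => s * (nrm2 (r k) / tk s k)) gap_drive 0 (fun k => nrm2_ge0 (r k))
  _ gap_drive_ge0 gap_step sum_gap_drive.
  by move=> k; rewrite mulr_ge0// ltW.
split=> //; apply: (@series_dominated _ _ _ s^-1 _ _ c2) => k //.
by rewrite mulrA mulVf ?mul1r// gt_eqF.
Qed.

Lemma gap_to0 : (fun k => nrm2 (r k)) @ \oo --> 0.
Proof.
have [c1 c2] := gap_cvg.
by apply: (cvg0_of_series_div_tk s) => // k; exact: nrm2_ge0.
Qed.

Lemma sum_w_le : cvgn (series (fun k => nrm2 (w k))).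
Proof.
apply: (@series_dominated _ _ _ 1 _ _ sum_w) => k; first exact: nrm2_ge0.
by rewrite mul1r ler_peMl ?nrm2_ge0// lerDr.
Qed.

(** The step [gam / s] does not tend to [0], so [- dotv (w k) zeta] must be summable by itself. Weak
    monotonicity replaces it by [dotv (w k) (r k)] and [rho * nrm2 (w k)], and Young with weight
    [t_k] uses the summability of [t_k |w^k|^2] and [|r^k|^2 / t_k]. *)
Lemma anchor_cvg xs : zerPhi G T xs -> cvgn (fun k => nrm2 (z k - xs)).
Proof.
move=> zx; have [_ sum_r] := gap_cvg.
have [_ _ _ rho0 _ _ _ _] := adm.
pose d k := eta * (rho * nrm2 (w k)) + (eta * (tk s k * nrm2 (w k)) +
  (eta * (nrm2 (r k) / tk s k) + (eta * (tk s k ^+ 2 * nrm2 (ep k)) +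
   eta ^+ 2 * (tk s k * nrm2 (wt k))))).
have d0 k : 0 <= d k.
  have t0 : 0 <= tk s k by have := t_ge8 k; lra.
  have e0 := ltW eta_gt0.
  rewrite /d; do !apply: addr_ge0; apply: mulr_ge0 => //; rewrite ?sqr_ge0//.
  - by rewrite mulr_ge0 ?nrm2_ge0.
  - by rewrite mulr_ge0 ?nrm2_ge0.
  - by rewrite divr_ge0 ?nrm2_ge0.
  - by rewrite mulr_ge0 ?sqr_ge0 ?nrm2_ge0.
  - by rewrite mulr_ge0 ?nrm2_ge0.
have cd : cvgn (series d).
  apply: is_cvg_series_add; first exact/is_cvg_seriesM/is_cvg_seriesM/sum_w_le.
  apply: is_cvg_series_add; first exact/is_cvg_seriesM/sum_tw.
  apply: is_cvg_series_add; first exact/is_cvg_seriesM/sum_r.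
  apply: is_cvg_series_add; first exact/is_cvg_seriesM/sum_ep.
  exact/is_cvg_seriesM/sum_twt.
have cb := is_cvg_seriesM _ eta (series_inv_sqr_tk s s_gt0).
have [] // := fejer_cvg (fun k => nrm2 (z k - xs)) (fun=> 0)
  (fun k => eta * (tk s k ^+ 2)^-1) d (fun k => nrm2_ge0 (z k - xs)) _ _ d0 _ cb cd.
- by move=> k; rewrite mulr_ge0 ?(ltW eta_gt0)// invr_ge0 sqr_ge0.
move=> k; rewrite addr0 (path_zeta G _ _ _ _ _ _ _ _ _ run).
have t8 := t_ge8 k; have t0 : 0 < tk s k by lra.
have [|g0 _ g1] := gam_bound _ _ _ _ (tk s k) adm; first lra.
set gs := gam s eta (tk s k) / s; set zeta := z k - xs.
have gs0 : 0 <= gs by rewrite divr_ge0 ?(ltW s_gt0).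
have gs1 : 2 * gs <= eta.
  rewrite /gs mulrA ler_pdivrMr//; have : 7 * eta <= s * eta.
    by rewrite ler_wpM2r ?(ltW eta_gt0)// ltW.
  by have := eta_gt0; lra.
have mono := resid_zer _ _ _ _ _ _ _ _ _ _ _ ops run xs k zx.
have t20 : 0 < tk s k / 2 by lra.
have y1 := dotv_young _ (w k) (r k) t20.
have half : 0 < 1 / 2 :> R by lra.
have y2 := dotv_youngN _ (tk s k *: ep k) ((tk s k)^-1 *: zeta) half.
rewrite dotvZl dotvZr mulrA divff ?gt_eqF// mul1r !nrm2Z in y2.
have xE : x k - xs = r k + zeta by rewrite /zeta addrA subrK.
rewrite xE dotvDr in mono.
have -> : nrm2 (zeta - gs *: (w k + ep k)) = nrm2 zeta
    + 2 * gs * (- dotv (w k) zeta - dotv (ep k) zeta)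
    + gs ^+ 2 * nrm2 (w k + ep k).
  by rewrite nrm2_subZ dotvDl; ring.
have W0 := nrm2_ge0 (w k); have E0 := nrm2_ge0 (ep k); have R0 := nrm2_ge0 (r k).
have Z0 := nrm2_ge0 zeta; have WT0 := nrm2_ge0 (wt k).
have rt : 0 <= nrm2 (r k) / tk s k by rewrite divr_ge0// ltW.
have zt : 0 <= (tk s k ^+ 2)^-1 * nrm2 zeta by rewrite mulr_ge0// invr_ge0 sqr_ge0.
have tw0 : 0 <= tk s k * nrm2 (w k) by rewrite mulr_ge0// ltW.
have te0 : 0 <= tk s k ^+ 2 * nrm2 (ep k) by rewrite mulr_ge0// sqr_ge0.
have rw0 : 0 <= rho * nrm2 (w k) by rewrite mulr_ge0.
have q1 : - dotv (w k) zeta - dotv (ep k) zeta <= rho * nrm2 (w k) +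
  tk s k * nrm2 (w k) + nrm2 (r k) / tk s k + tk s k ^+ 2 * nrm2 (ep k)
  + (tk s k ^+ 2)^-1 * nrm2 zeta.
  rewrite exprVn in y2.
  have e1 : nrm2 (r k) / (4 * (tk s k / 2)) = nrm2 (r k) / tk s k / 2.
    by field; rewrite gt_eqF.
  rewrite e1 in y1; move: y1 y2 mono rt zt tw0 te0.
  set a1 := nrm2 (r k) / tk s k; set a2 := _^-1 * nrm2 zeta.
  lra.
have q2 : 2 * gs * (- dotv (w k) zeta - dotv (ep k) zeta) <= eta *
  (rho * nrm2 (w k) + tk s k * nrm2 (w k) + nrm2 (r k) / tk s k
   + tk s k ^+ 2 * nrm2 (ep k) + (tk s k ^+ 2)^-1 * nrm2 zeta).
  apply: (@le_trans _ _ (2 * gs * (rho * nrm2 (w k) + tk s k * nrm2 (w k)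
     + nrm2 (r k) / tk s k + tk s k ^+ 2 * nrm2 (ep k) + (tk s k ^+ 2)^-1 * nrm2 zeta))).
    by rewrite ler_wpM2l// mulr_ge0.
  by rewrite ler_wpM2r// !addr_ge0.
have q3 : gs ^+ 2 * nrm2 (w k + ep k) <= eta ^+ 2 * (tk s k * nrm2 (wt k)).
  rewrite (resid_shift G x v Gm).
  apply: ler_pM; rewrite ?sqr_ge0//; last by rewrite ler_peMl//; lra.
  by rewrite ler_pXn2r ?nnegrE//; have := eta_gt0; lra.
move: q2 q3; rewrite /d.
set a1 := nrm2 (r k) / tk s k; set a2 := (tk s k ^+ 2)^-1.
lra.
Qed.

(* The multiple of the gap makes the energy nonnegative; it converges because
   both summands almost decrease, and its limit is [0] because it is summable
   against [1 / t_k]. *)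
Definition gap_energy k : R :=
  energy s eta Bc (k%:R + s) (w k) (r k) + s ^+ 2 / (eta - Bc) * nrm2 (r k).

Let gap0 : 0 < eta - Bc. Proof. exact: admissible_gap adm. Qed.

(** Young at weight [(eta - Bc) / 4] spends half of the leading square and produces exactly the
    multiple [s ^+ 2 / (eta - Bc)] of the gap. *)
Lemma gap_energy_ge k :
  (eta - Bc) / 4 * ((k%:R + s) ^+ 2 * nrm2 (w k)) <= gap_energy k.
Proof.
have [_ eta0 B0 _ Beta _ _ _] := adm.
set Tk := k%:R + s.
have T0 : 0 <= Tk by rewrite /Tk addr_ge0// ltW.
have a0 : 0 < (eta - Bc) / 4 by have := gap0; lra.
have := dotv_youngN _ (Tk *: w k) (s *: r k) a0.
rewrite dotvZl dotvZr !nrm2Z.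
have -> : s ^+ 2 * nrm2 (r k) / (4 * ((eta - Bc) / 4)) = s ^+ 2 / (eta - Bc) * nrm2 (r k).
  by field; rewrite gt_eqF.
rewrite /gap_energy /energy -/Tk.
have : 0 <= Tk * (s * ((eta + Bc) / 2)) * nrm2 (w k).
  rewrite mulr_ge0 ?nrm2_ge0// mulr_ge0// mulr_ge0 ?(ltW s_gt0)//; lra.
set a := s ^+ 2 / (eta - Bc) * nrm2 (r k).
lra.
Qed.

Lemma gap_energy_le k : gap_energy k / tk s k <=
  3 * eta * (tk s k * nrm2 (w k))
  + (s ^+ 2 / (4 * eta) + s ^+ 2 / (eta - Bc)) * (nrm2 (r k) / tk s k).
Proof.
have [_ eta0 B0 _ Beta _ _ _] := adm.
have t8 := t_ge8 k; have t0 : 0 < tk s k by lra.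
have k0 : 0 <= k%:R :> R by [].
rewrite /gap_energy /energy; set Tk := k%:R + s.
have T0 : 0 <= Tk by rewrite /Tk addr_ge0// ltW.
have Tt : Tk <= tk s k by rewrite /tk /Tk lerDl.
have st : s <= tk s k by rewrite /tk; lra.
have := dotv_young _ (Tk *: w k) (s *: r k) eta0.
rewrite dotvZl dotvZr !nrm2Z => y.
have W0 := nrm2_ge0 (w k).
have h1 : Tk ^+ 2 * nrm2 (w k) <= tk s k ^+ 2 * nrm2 (w k).
  by rewrite ler_wpM2r// ler_pXn2r ?nnegrE ?(ltW t0).
have h2 : Tk * (Tk * ((eta - Bc) / 2) + s * ((eta + Bc) / 2)) <= tk s k * (tk s k * (2 * eta)).
  apply: ler_pM => //.
    by rewrite addr_ge0// mulr_ge0 ?(ltW s_gt0)//; have := gap0; lra.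
  have -> : tk s k * (2 * eta) = tk s k * eta + tk s k * eta by ring.
  by apply: lerD; apply: ler_pM; rewrite ?(ltW s_gt0)//; have := gap0; lra.
have {}h2 := ler_wpM2r W0 h2.
rewrite ler_pdivrMr//.
have -> : (3 * eta * (tk s k * nrm2 (w k)) + (s ^+ 2 / (4 * eta) + s ^+ 2 / (eta - Bc)) *
   (nrm2 (r k) / tk s k)) * tk s k = 3 * eta * (tk s k ^+ 2 * nrm2 (w k)) +
   s ^+ 2 * nrm2 (r k) / (4 * eta) + s ^+ 2 / (eta - Bc) * nrm2 (r k).
  by field; rewrite !gt_eqF.
have h3 := ler_wpM2l (ltW eta0) h1.
move: y h2 h3.
set a := s ^+ 2 / (eta - Bc) * nrm2 (r k); set b := s ^+ 2 * nrm2 (r k) / (4 * eta).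
lra.
Qed.

Definition energy_drive k : R :=
  s ^+ 2 * (tk s k * nrm2 (w k)) + (s ^+ 2 * (nrm2 (r k) / tk s k) +
  (eta * (s + 2) * (tk s k ^+ 2 * nrm2 (ep k.+1)) +
  (2 * eta * (tk s k ^+ 2 * nrm2 (ep k)) +
   (eta * (5 * s ^+ 2 + 5 * (s + 1) ^+ 2) * nrm2 (w k) +
   s ^+ 2 / (eta - Bc) * gap_drive k)))).

Lemma energy_drive_ge0 k : 0 <= energy_drive k.
Proof.
have t8 := t_ge8 k.
have t0 : 0 <= tk s k by lra.
have e0 := ltW eta_gt0; have s2 : 0 <= s + 2 by have := s_gt0; lra.
have w0 := nrm2_ge0 (w k).
have q1 : 0 <= tk s k * nrm2 (w k) by rewrite mulr_ge0.
have q2 : 0 <= nrm2 (r k) / tk s k by rewrite divr_ge0 ?nrm2_ge0.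
have q3 j : 0 <= tk s k ^+ 2 * nrm2 (ep j) by rewrite mulr_ge0 ?sqr_ge0 ?nrm2_ge0.
have q4 := gap_drive_ge0 k.
rewrite /energy_drive; do !apply: addr_ge0; apply: mulr_ge0 => //; rewrite ?sqr_ge0//.
- exact: mulr_ge0.
- exact: mulr_ge0.
- by rewrite mulr_ge0// addr_ge0// mulr_ge0 ?sqr_ge0.
- by rewrite divr_ge0 ?sqr_ge0// ltW.
Qed.

Lemma sum_energy_drive : cvgn (series energy_drive).
Proof.
have [_ sum_r] := gap_cvg.
have cep := sum_ep.
have ctw := sum_tw.
apply: is_cvg_series_add; first exact: is_cvg_seriesM.
apply: is_cvg_series_add; first exact: is_cvg_seriesM.
apply: is_cvg_series_add.
  exact/is_cvg_seriesM/(sum_epS).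
apply: is_cvg_series_add; first exact/is_cvg_seriesM.
apply: is_cvg_series_add; first exact/is_cvg_seriesM/(sum_w_le).
exact/is_cvg_seriesM/(sum_gap_drive).
Qed.

(** No zero enters: the term in [dotv (w k) (r k)], treated in [lyap_step] by monotonicity at a
    zero, is now summable by Young. As all errors are summable too, large constants are harmless and
    every index is allowed. *)
Lemma gap_energy_step k : gap_energy k.+1 <= gap_energy k + energy_drive k.
Proof.
have [_ eta0 B0 rho0 Beta _ gap _] := adm.
have k0 : 0 <= k%:R :> R by [].
have m0 : 0 < k%:R + 1 :> R by lra.
have t8 := t_ge8 k; have t0 : 0 < tk s k by lra.
have t1 : 1 <= tk s k by lra.
have tE : tk s k = k%:R + 1 + s by rewrite /tk; ring.
have tE1 : tk s k - 1 = k%:R + s by rewrite /tk; ring.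
have step := energy_step s eta Bc rho _ _ _ _ _ _ _ _ _ _ tE m0 s_gt0
  (path_incr G _ _ _ _ _ _ _ _ _ adm run k) (path_r G _ _ _ _ _ _ _ _ _ run k)
  (resid_mono _ _ _ _ _ _ _ _ _ _ _ ops run k).
have cross := cross_step s eta Bc rho _ _ (w k) (ep k) (ep k.+1) adm (ltW m0) tE.
have weight := weight_step s eta Bc rho (k%:R + 1) _ (w k) adm (ltW m0) t1.
have gapst := gap_step k.
have E1 : gap_energy k.+1 = energy s eta Bc (tk s k) (w k.+1) (r k.+1)
    + s ^+ 2 / (eta - Bc) * nrm2 (r k.+1).
  by rewrite /gap_energy; congr (energy _ _ _ _ _ _ + _); rewrite /tk -natr1; ring.
rewrite E1 /gap_energy /energy_drive -tE1.
have W0 := nrm2_ge0 (w k); have E0 := nrm2_ge0 (ep k); have E'0 := nrm2_ge0 (ep k.+1).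
have R0 := nrm2_ge0 (r k); have D0 := nrm2_ge0 (w k.+1 - w k).
have c0 : 0 <= s ^+ 2 / (eta - Bc) by rewrite divr_ge0 ?sqr_ge0// ltW.
have h1 : s ^+ 2 / (eta - Bc) * nrm2 (r k.+1) <=
    s ^+ 2 / (eta - Bc) * (nrm2 (r k) + gap_drive k).
  apply: ler_wpM2l => //; apply: le_trans gapst.
  by rewrite lerDl mulr_ge0 ?(ltW s_gt0)// divr_ge0// ltW.
(* A weight proportional to [k + 1] lets the increment be absorbed even for small [k]; the price
   [t_k / (k + 1)] is at most [s + 1]. The two increment terms use [1 / 4] each of the available
   [1 / 2]. *)
have m40 : 0 < (k%:R + 1) / 4 :> R by lra.
have y1 := dotv_youngN _ (w k.+1 - w k) (tk s k *: ep k.+1) m40.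
rewrite dotvZr nrm2Z in y1.
have h2 : - (tk s k ^+ 2 * eta * dotv (w k.+1 - w k) (ep k.+1)) <=
   eta * ((k%:R + 1) * tk s k / 4 * nrm2 (w k.+1 - w k)
          + (s + 1) * (tk s k ^+ 2 * nrm2 (ep k.+1))).
  have -> : - (tk s k ^+ 2 * eta * dotv (w k.+1 - w k) (ep k.+1)) =
    eta * (tk s k * - (tk s k * dotv (w k.+1 - w k) (ep k.+1))) by ring.
  rewrite ler_pM2l//.
  apply: le_trans (ler_wpM2l (ltW t0) y1) _.
  have -> : tk s k * ((k%:R + 1) / 4 * nrm2 (w k.+1 - w k) +
    tk s k ^+ 2 * nrm2 (ep k.+1) / (4 * ((k%:R + 1) / 4))) =
    (k%:R + 1) * tk s k / 4 * nrm2 (w k.+1 - w k) +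
    tk s k / (k%:R + 1) * (tk s k ^+ 2 * nrm2 (ep k.+1)).
    by field; rewrite gt_eqF.
  rewrite lerD2l; apply: ler_wpM2r; first by apply: mulr_ge0; rewrite ?sqr_ge0.
  rewrite ler_pdivrMr// /tk.
  by have := mulr_ge0 (ltW s_gt0) k0; lra.
have q4 : 0 < 1 / 4 :> R by lra.
have y2 := dotv_young _ (w k.+1 - w k) (ep k) q4.
have h3 : tk s k * (k%:R + 1) * Bc * dotv (w k.+1 - w k) (ep k) <=
   eta * ((k%:R + 1) * tk s k / 4 * nrm2 (w k.+1 - w k) + tk s k ^+ 2 * nrm2 (ep k)).
  apply: (@le_trans _ _ (tk s k * (k%:R + 1) * Bc *
     (1 / 4 * nrm2 (w k.+1 - w k) + nrm2 (ep k)))).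
    apply: ler_wpM2l; first by rewrite !mulr_ge0// ltW.
    by apply: le_trans y2 _; rewrite lerD2l; lra.
  apply: (@le_trans _ _ (tk s k * (k%:R + 1) * eta *
     (1 / 4 * nrm2 (w k.+1 - w k) + nrm2 (ep k)))).
    apply: ler_wpM2r; first lra.
    by apply: ler_wpM2l => //; rewrite mulr_ge0// ltW.
  have : tk s k * (k%:R + 1) * (eta * nrm2 (ep k)) <= tk s k * tk s k * (eta * nrm2 (ep k)).
    apply: ler_wpM2r; first by rewrite mulr_ge0// ltW.
    by rewrite ler_pM2l// tE; have := s_gt0; lra.
  lra.
have h4 : 1 / 2 * eta * ((k%:R + 1) * tk s k) * nrm2 (w k.+1 - w k) <=
  ((Bc + eta) / 2 - rho) * ((k%:R + 1) * tk s k) * nrm2 (w k.+1 - w k).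
  apply: ler_wpM2r => //; apply: ler_wpM2r; first by rewrite mulr_ge0// ltW.
  lra.
have t20 : 0 < tk s k / 2 by lra.
have y3 := dotv_youngN _ (w k) (r k) t20.
have e1 : nrm2 (r k) / (4 * (tk s k / 2)) = nrm2 (r k) / tk s k / 2.
  by field; rewrite gt_eqF.
rewrite e1 in y3.
have ss0 : 0 <= s * (s - 1) by rewrite mulr_ge0 ?(ltW s_gt0)//; have := s_gt7; lra.
have rt : 0 <= nrm2 (r k) / tk s k by rewrite divr_ge0// ltW.
have tw0 : 0 <= tk s k * nrm2 (w k) by rewrite mulr_ge0// ltW.
have h5 : s * (s - 1) * (- dotv (w k) (r k)) <=
    s ^+ 2 * (tk s k * nrm2 (w k)) + s ^+ 2 * (nrm2 (r k) / tk s k).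
  rewrite -mulrDr.
  apply: (@le_trans _ _ (s * (s - 1) * (tk s k * nrm2 (w k) + nrm2 (r k) / tk s k))).
    apply: ler_wpM2l => //; lra.
  apply: ler_wpM2r; first exact: addr_ge0.
  by have := s_gt0; lra.
have h6 : 0 <= eta / (4 * (s - 2)) * (k%:R + 1) * nrm2 (w k) + s * (s - 1) * rho * nrm2 (w k).
  apply: addr_ge0; last by rewrite mulr_ge0// mulr_ge0.
  rewrite mulr_ge0// mulr_ge0 ?(ltW m0)// divr_ge0 ?(ltW eta0)//.
  by have := s_gt7; lra.
have te0 : 0 <= eta * (tk s k ^+ 2 * nrm2 (ep k)).
  by apply: mulr_ge0 (ltW eta0) _; apply: mulr_ge0; rewrite ?sqr_ge0.
have te'0 : 0 <= eta * (tk s k ^+ 2 * nrm2 (ep k.+1)).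
  by apply: mulr_ge0 (ltW eta0) _; apply: mulr_ge0; rewrite ?sqr_ge0.
have {}weight := le_trans h6 weight.
move: step cross weight h1 h2 h3 h4 h5 te0 te'0.
set a1 := s ^+ 2 / (eta - Bc); set a2 := nrm2 (r k) / tk s k.
set a3 := gam s eta (tk s k); set a4 := energy _ _ _ _ _ _; set a5 := energy _ _ _ _ _ _.
set a6 := ((Bc + eta) / 2 - rho) * ((k%:R + 1) * tk s k) * nrm2 (w k.+1 - w k).
set a7 := (((s - 1) * (eta - Bc) - a3) * (k%:R + 1) + _) * nrm2 (w k).
set a8 := 5 * s ^+ 2 + 5 * (s + 1) ^+ 2.
clearbody a1 a2 a3 a4 a5 a6 a7 a8.
lra.
Qed.

Lemma gap_energy_to0 : gap_energy @ \oo --> 0.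
Proof.
have [_ sum_r] := gap_cvg.
have ctw := sum_tw.
have h0 k : 0 <= gap_energy k.
  apply: le_trans (gap_energy_ge k).
  apply: mulr_ge0; first by have := gap0; lra.
  by apply: mulr_ge0; rewrite ?sqr_ge0 ?nrm2_ge0.
apply: (cvg0_of_series_div_tk s) => //.
  have step k : gap_energy k.+1 + 0 <= gap_energy k + energy_drive k.
    by rewrite addr0; exact: gap_energy_step.
  by have [] := descent_cvg _ (fun=> 0) _ 0 h0 (fun=> lexx 0) energy_drive_ge0 step
    sum_energy_drive.
apply: (@series_dominated _ _ _ 1 _ _ (is_cvg_series_add _ _
  (is_cvg_seriesM _ (3 * eta) ctw)
  (is_cvg_seriesM _ (s ^+ 2 / (4 * eta) + s ^+ 2 / (eta - Bc)) sum_r))) => k.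
  by rewrite divr_ge0//; have := t_ge8 k; lra.
by rewrite mul1r; exact: gap_energy_le.
Qed.

Lemma resid_to0 : (fun k => (k%:R + s) ^+ 2 * nrm2 (w k)) @ \oo --> 0.
Proof.
have h : (fun k => 4 / (eta - Bc) * gap_energy k) @ \oo --> 0.
  by rewrite -[0](mulr0 (4 / (eta - Bc))); apply: cvgMl_tmp gap_energy_to0.
apply: (squeeze_cvgr _ (cvg_cst 0) h); near=> k.
rewrite mulr_ge0 ?sqr_ge0 ?nrm2_ge0//=.
have := gap_energy_ge k.
have := gap0 => g0.
rewrite -(ler_pM2l (_ : 0 < 4 / (eta - Bc))) ?divr_gt0//; apply: le_trans.
by rewrite le_eqVlt; apply/orP; left; apply/eqP; field; rewrite gt_eqF.
Unshelve. all: by end_near. Qed.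

Lemma sqr_resid_to0 : (fun k => k%:R ^+ 2 * nrm2 (w k)) @ \oo --> 0.
Proof.
apply: (squeeze_cvgr _ (cvg_cst 0) resid_to0); near=> k.
rewrite mulr_ge0 ?sqr_ge0 ?nrm2_ge0//= ler_wpM2r ?nrm2_ge0//.
have s0 := ltW s_gt0.
by rewrite ler_pXn2r ?nnegrE ?addr_ge0// lerDl.
Unshelve. all: by end_near. Qed.

Lemma sqr_lagged_resid_to0 :
  (fun k => k%:R ^+ 2 * nrm2 (G (ym k) + v k)) @ \oo --> 0.
Proof.
have c1 := cvg_series_cvg_0 (sum_ep).
have c2 := cvg_series_cvg_0 (sum_en0).
have h : (fun k => 2 * ((k%:R + s) ^+ 2 * nrm2 (w k)) +
   (4 * (tk s k ^+ 2 * nrm2 (ep k)) + 4 * (tk s k ^+ 2 * nrm2 (en k)))) @ \oo --> 0.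
  rewrite -[0](_ : 2 * 0 + (4 * 0 + 4 * 0) = 0 :> R); last by rewrite !mulr0 !addr0.
  apply: cvgD; first exact: cvgMl_tmp resid_to0.
  by apply: cvgD; [exact: cvgMl_tmp c1|exact: cvgMl_tmp c2].
apply: (squeeze_cvgr _ (cvg_cst 0) h); near=> k.
rewrite mulr_ge0 ?sqr_ge0 ?nrm2_ge0//=.
have k0 : 0 <= k%:R :> R by [].
have s0 := s_gt0.
have d1 : k%:R ^+ 2 <= (k%:R + s) ^+ 2 by rewrite ler_pXn2r ?nnegrE//; lra.
have d2 : k%:R ^+ 2 <= tk s k ^+ 2 by rewrite /tk ler_pXn2r ?nnegrE//; lra.
have -> : G (ym k) + v k = w k + (ep k - en k).
  by rewrite /resid /shift_err /est_err; apply/rowP => i; rewrite !mxE; ring.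
have f1 := nrm2D_le (w k) (ep k - en k); have f2 := nrm2B_le (ep k) (en k).
have g1 := ler_wpM2r (nrm2_ge0 (w k)) d1.
have g2 := ler_wpM2r (nrm2_ge0 (ep k)) d2.
have g3 := ler_wpM2r (nrm2_ge0 (en k)) d2.
have : k%:R ^+ 2 * nrm2 (w k + (ep k - en k)) <= k%:R ^+ 2 *
   (2 * nrm2 (w k) + 4 * nrm2 (ep k) + 4 * nrm2 (en k)).
  by rewrite ler_wpM2l ?sqr_ge0//; lra.
lra.
Unshelve. all: by end_near. Qed.

(** * Cluster points and convergence of the iterates *)

Lemma nrm2_resid_to0 : (fun k => nrm2 (w k)) @ \oo --> 0.
Proof. exact: cvg_series_cvg_0 sum_w_le. Qed.

Lemma lag_to0 : (fun k => nrm2 (x k.+1 - ym k.+1)) @ \oo --> 0.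
Proof.
apply: (squeeze_cvgr _ (cvg_cst 0) (cvg_series_cvg_0 sum_lag)); near=> k.
rewrite nrm2_ge0 /= ler_peMl ?nrm2_ge0//.
by have := t_ge8 k => t8; rewrite expr_ge1//; lra.
Unshelve. all: by end_near. Qed.

Lemma path_cvg : (exists xs, zerPhi G T xs) ->
  closed [set xw : 'rV[R]_p * 'rV[R]_p | graPhi G T xw.1 xw.2] ->
  exists2 l, zerPhi G T l &
    [/\ x @ \oo --> l, (fun k => ym k.+1) @ \oo --> l & z @ \oo --> l].
Proof.
move=> [xs zx] clo.
have [M xM] : exists M, forall k, nrm2 (x k) <= M.
  have [Mz zM] := cvg_seq_bounded_le (anchor_cvg xs zx).
  have [Mr rM] := cvg_seq_bounded_le (proj1 gap_cvg).
  exists (2 * Mr + 4 * Mz + 4 * nrm2 xs) => k.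
  have -> : x k = r k + ((z k - xs) + xs).
    by apply/rowP => i; rewrite !mxE; ring.
  have := nrm2D_le (r k) ((z k - xs) + xs); have := nrm2D_le (z k - xs) xs.
  have := zM k; have := rM k; rewrite /=; lra.
have [l xl] := nrm2_bounded_cluster _ _ xM.
have zl : zerPhi G T l.
  apply: (clo (l, 0)) => B [[U V] /= [lU zV] UVB].
  have wV : \forall k \near \oo, V (w k).
    by apply: (cvg_of_nrm2 _ 0 _) => //; under eq_fun do rewrite subr0;
       exact: nrm2_resid_to0.
  (* A cluster point meets the image under [x] of every eventual set of indices. This gives one
     index with [x k] near [l] and [w k] near [0], in place of a subsequence. *)
  have [y [[k [-> Vk]] Uy]] := xl [set y | exists k, y = x k /\ V (w k)] U
    (filterS (fun k Vk => ex_intro _ k (conj erefl Vk)) wV) lU.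
  exists (x k, w k); split; last exact: UVB.
  exact: (graPhi_resid _ _ _ _ _ _ _ _ _ _ run).
have cz := anchor_cvg l zl.
set c := limn (fun k => nrm2 (z k - l)) in cz.
have c0 : 0 <= c by apply: limr_ge => //; near=> k; exact: nrm2_ge0.
(* Otherwise some index has [x k] close to [l] and a small gap, so that [nrm2 (z k - l) < c / 4],
   against its eventual lower bound [c / 2]. *)
have c_eq0 : c = 0.
  apply/eqP/negP => /negP c_neq0.
  have c_gt0 : 0 < c by rewrite lt_neqAle eq_sym c_neq0.
  have ev : \forall k \near \oo, c / 2 < nrm2 (z k - l) /\ nrm2 (r k) < c / 16.
    near=> k; split; near: k.
      by apply: (cvgr_gt c cz); lra.
    by apply: (cvgr_lt 0 gap_to0); lra.
  have [y [[k [-> [zk rk]]] /= Uy]] := xl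
    [set y | exists k, y = x k /\ (c / 2 < nrm2 (z k - l) /\ nrm2 (r k) < c / 16)]
    [set y | nrm2 (y - l) < c / 16]
    (filterS (fun k Vk => ex_intro _ k (conj erefl Vk)) ev)
    (nbhs_nrm2 l _ (divr_gt0 c_gt0 (ltr0n _ 16))).
  have := nrm2B_le (x k - l) (r k).
  have -> : x k - l - r k = z k - l by apply/rowP => i; rewrite !mxE; ring.
  move: zk rk Uy; lra.
have zl0 : (fun k => nrm2 (z k - l)) @ \oo --> 0 by rewrite -c_eq0.
have xl0 : (fun k => nrm2 (x k - l)) @ \oo --> 0.
  have h : (fun k => 2 * nrm2 (r k) + 2 * nrm2 (z k - l)) @ \oo --> 0.
    rewrite -[0](_ : 2 * 0 + 2 * 0 = 0 :> R); last by rewrite !mulr0 addr0.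
    by apply: cvgD; [exact: cvgMl_tmp gap_to0|exact: cvgMl_tmp zl0].
  apply: (squeeze_cvgr _ (cvg_cst 0) h); near=> k.
  rewrite nrm2_ge0 /=; have -> : x k - l = r k + (z k - l) by rewrite addrA subrK.
  exact: nrm2D_le.
exists l => //; split; apply: cvg_of_nrm2 => //.
have h : (fun k => 2 * nrm2 (x k.+1 - l) + 2 * nrm2 (x k.+1 - ym k.+1)) @ \oo --> 0.
  rewrite -[0](_ : 2 * 0 + 2 * 0 = 0 :> R); last by rewrite !mulr0 addr0.
  apply: cvgD; last exact: cvgMl_tmp lag_to0.
  apply: cvgMl_tmp; exact: (cvg_comp _ _ (@cvg_addnl 1) xl0).
apply: (squeeze_cvgr _ (cvg_cst 0) h); near=> k.
rewrite nrm2_ge0 /=.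
have -> : ym k.+1 - l = (x k.+1 - l) - (x k.+1 - ym k.+1).
  by apply/rowP => i; rewrite !mxE; ring.
exact: nrm2B_le.
Unshelve. all: by end_near. Qed.

End PathConvergence.

(** * Square integrable random vectors *)

Section RandomVectors.
Context {d : measure_display} {Omega : measurableType d} {R : realType} {p : nat}.
Implicit Types (U V : Omega -> 'rV[R]_p) (f g : Omega -> R).

Definition measurable_vec U : Prop :=
  forall i, measurable_fun setT (fun o => U o ord0 i).

Lemma measurable_vec_cst u : measurable_vec (fun=> u).
Proof. by move=> i; exact: measurable_cst. Qed.

Lemma measurable_vecD U V : measurable_vec U -> measurable_vec V ->
  measurable_vec (fun o => U o + V o).
Proof.
move=> mU mV i; rewrite (_ : (fun o => _) = (fun o => U o ord0 i) \+ (fun o => V o ord0 i)).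
  exact: measurable_funD.
by apply/funext => o /=; rewrite mxE.
Qed.

Lemma measurable_vecZ a U : measurable_vec U -> measurable_vec (fun o => a *: U o).
Proof.
move=> mU i; rewrite (_ : (fun o => _) = (cst a \* (fun o => U o ord0 i))).
  exact: measurable_funM.
by apply/funext => o /=; rewrite mxE.
Qed.

Lemma measurable_vecB U V : measurable_vec U -> measurable_vec V ->
  measurable_vec (fun o => U o - V o).
Proof.
move=> mU mV; under eq_fun do rewrite -scaleN1r.
by apply: measurable_vecD => //; exact: measurable_vecZ.
Qed.

Lemma measurable_dotv U V : measurable_vec U -> measurable_vec V ->
  measurable_fun setT (fun o => dotv (U o) (V o)).
Proof.
by move=> mU mV; apply: measurable_sum => i; exact: measurable_funM.
Qed.

(** Measurability is coordinatewise, so the open set is exhausted by the countably many rational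
    boxes it contains. Width [1 / (n + 1)] with [2 / (n + 1) < e] keeps a box around the given point
    inside its ball. *)
Lemma preimage_open_measurable U (O : set 'rV[R]_p) :
  measurable_vec U -> open O -> measurable (U @^-1` O).
Proof.
move=> mU oO.
pose box (c : 'rV[rat]_p * nat) : set 'rV[R]_p :=
  [set y | forall i, `|y ord0 i - ratr (c.1 ord0 i)| < c.2.+1%:R^-1].
have mbox c : measurable (U @^-1` box c).
  rewrite (_ : U @^-1` box c = \bigcap_(i in [set: 'I_p])
     ((fun o => `|U o ord0 i - ratr (c.1 ord0 i)|) @^-1` `]-oo, c.2.+1%:R^-1[)).
    apply: fin_bigcap_measurable => // i _; rewrite -[X in measurable X]setTI.
    have mf : measurable_fun setT (fun o => `|U o ord0 i - ratr (c.1 ord0 i)|).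
      by apply: measurableT_comp => //; exact: measurable_funB.
    exact: (mf measurableT _ (measurable_itv _)).
  apply/seteqP; split=> o /= h i; first by move=> _; rewrite /= in_itv/=.
  by have := h i I; rewrite /= in_itv.
rewrite (_ : U @^-1` O = \bigcup_c (if `[< box c `<=` O >] then U @^-1` box c else set0)).
  apply: countable_bigcupT_measurable; first exact: countableP.
  by move=> c; case: ifP.
apply/seteqP; split=> o /=; last first.
  by move=> [c _]; case: ifPn => // /asboolP cO; exact: cO.
move=> Oo.
have /nbhs_ballP[e /= e0 eO] : nbhs (U o) O by exact: open_nbhs_nbhs.
have [n ne] : exists n, 2 * n.+1%:R^-1 < e.
  exists (Num.bound (2 / e)); have := archi_boundP (ltW (divr_gt0 (ltr0n R 2) e0)).
  rewrite ltr_pdivrMr// => h; rewrite ltr_pdivrMr// mulrC.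
  by apply: lt_le_trans h _; rewrite ler_wpM2r ?(ltW e0)// ler_nat.
have n0 : 0 < n.+1%:R^-1 :> R by rewrite invr_gt0.
have /choice[q qU] : forall i, exists q, `|U o ord0 i - ratr q| < n.+1%:R^-1.
  move=> i; have [|q] := rat_in_itvoo (_ : U o ord0 i < U o ord0 i + n.+1%:R^-1).
    by rewrite ltrDl.
  rewrite in_itv/= => /andP[q1 q2]; exists q.
  by rewrite distrC ger0_norm ?subr_ge0 ?(ltW q1)// ltrBlDl.
exists (\row_i q i, n) => //; rewrite ifT; last first.
  apply/asboolP => y yq; apply: eO; split=> // i j; rewrite ord1 -ball_normE /=.
  have := yq j; rewrite /= mxE => h1; have h2 := qU j.
  apply: le_lt_trans ne; rewrite mulr_natl mulr2n.
  apply: le_trans (_ : `|U o ord0 j - ratr (q j)| + `|y ord0 j - ratr (q j)| <= _).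
    rewrite (distrC (y ord0 j)).
    have := ler_normD (U o ord0 j - ratr (q j)) (ratr (q j) - y ord0 j).
    by rewrite addrA subrK.
  by rewrite lerD ?ltW.
by move=> i /=; rewrite mxE.
Qed.

Lemma measurable_fun_lipschitz_comp (G : 'rV[R]_p -> 'rV[R]_p) L U :
  (forall y y', nrm2 (G y - G y') <= L ^+ 2 * nrm2 (y - y')) ->
  measurable_vec U -> measurable_vec (fun o => G (U o)).
Proof.
move=> lipG mU i.
have cG : continuous (fun y => G y ord0 i).
  move=> y; apply/(@cvgrPdist_lt _ _ _ (nbhs y)) => e e0.
  (* The [+ 1] avoids a division by zero when [L = 0]. *)
  pose a := e ^+ 2 / (L ^+ 2 + 1).
  have L1 : 0 < L ^+ 2 + 1 by rewrite ltr_wpDl ?sqr_ge0.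
  have a0 : 0 < a by rewrite divr_gt0 ?exprn_gt0.
  near=> y'; have yy' : nrm2 (y' - y) < a by near: y'; exact: nbhs_nrm2.
  rewrite -(@ltr_pXn2r _ 2)// ?nnegrE ?(ltW e0)// real_normK ?num_real//.
  have := sqr_coord_le (G y - G y') i; rewrite !mxE => /le_lt_trans; apply.
  apply: le_lt_trans (lipG _ _) _; rewrite nrm2B.
  apply: (@le_lt_trans _ _ ((L ^+ 2 + 1) * nrm2 (y' - y))).
    by rewrite ler_wpM2r ?nrm2_ge0// lerDl.
  by rewrite mulrC -ltr_pdivlMr.
apply: (measurability _ (RGenOInfty.measurableE R)) => //.
move=> _ [_ [a ->] <-]; rewrite setTI.
rewrite (_ : _ @^-1` _ = U @^-1` ((fun y => G y ord0 i) @^-1` `]a, +oo[%classic)).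
  by apply: preimage_open_measurable => //; apply: open_comp => //; exact: interval_open.
by [].
Unshelve. all: by end_near. Qed.

End RandomVectors.

(** * Integrability, means, and almost sure summability *)

Section SquareIntegrable.
Context {d : measure_display} {Omega : measurableType d} {R : realType} {p : nat}.
Variable P : probability Omega R.
Implicit Types (U V : Omega -> 'rV[R]_p) (f g : Omega -> R).

Definition intg f : Prop := P.-integrable setT (EFin \o f).

Lemma intgD f g : intg f -> intg g -> intg (fun o => f o + g o).
Proof. exact: integrableD. Qed.

Lemma intgZ a f : intg f -> intg (fun o => a * f o).
Proof. exact: integrableZl. Qed.

Lemma intg_cst a : intg (fun=> a).
Proof. exact: finite_measure_integrable_cst. Qed.

Lemma intg_dom f g : measurable_fun setT f -> (forall o, `|f o| <= g o) ->
  intg g -> intg f.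
Proof.
move=> mf fg ig; apply: le_integrable ig => //; first exact/measurable_EFinP.
by move=> o _ /=; rewrite lee_fin (le_trans (fg o))// ler_norm.
Qed.

Lemma intg_le f g : measurable_fun setT f -> (forall o, 0 <= f o) -> intg g ->
  (\int[P]_o (f o)%:E <= \int[P]_o (g o)%:E)%E -> intg f.
Proof.
move=> mf f0 ig fg; apply/integrableP; split; first exact/measurable_EFinP.
under eq_integral do rewrite /= ger0_norm//.
apply: (le_lt_trans fg).
by rewrite -(fineK (integrable_fin_num measurableT ig)) ltry.
Qed.

Definition mean f : R := \int[P]_o f o.

Lemma meanD f g : intg f -> intg g -> mean (fun o => f o + g o) = mean f + mean g.
Proof. exact: RintegralD. Qed.

Lemma meanZ a f : intg f -> mean (fun o => a * f o) = a * mean f.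
Proof. exact: RintegralZl. Qed.

Lemma mean_lin3 f1 f2 f3 a1 a2 a3 : intg f1 -> intg f2 -> intg f3 ->
  mean (fun o => a1 * f1 o + a2 * f2 o + a3 * f3 o) =
  a1 * mean f1 + a2 * mean f2 + a3 * mean f3.
Proof.
move=> I1 I2 I3; have J i f := intgZ i f.
rewrite meanD; [|exact: intgD (J _ _ I1) (J _ _ I2)|exact: J].
by rewrite meanD ?meanZ//; exact: J.
Qed.

Lemma mean_lin4 f1 f2 f3 f4 a2 a3 a4 :
  intg f1 -> intg f2 -> intg f3 -> intg f4 ->
  mean (fun o => f1 o + a2 * f2 o + a3 * f3 o + a4 * f4 o) =
  mean f1 + a2 * mean f2 + a3 * mean f3 + a4 * mean f4.
Proof.
move=> I1 I2 I3 I4; have J i f := intgZ i f.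
rewrite meanD; [|exact: intgD (intgD _ _ I1 (J _ _ I2)) (J _ _ I3)|exact: J].
rewrite meanD; [|exact: intgD I1 (J _ _ I2)|exact: J].
by rewrite meanD ?meanZ//; exact: J.
Qed.

Lemma mean_cst a : mean (fun=> a) = a.
Proof. by rewrite /mean Rintegral_cst// [X in fine X](@probability_setT _ _ _ P) mulr1. Qed.

Lemma mean_le f g : intg f -> intg g -> (forall o, f o <= g o) -> mean f <= mean g.
Proof. by move=> If Ig fg; exact: le_Rintegral. Qed.

Lemma mean_ge0 f : (forall o, 0 <= f o) -> 0 <= mean f.
Proof. by move=> f0; exact: Rintegral_ge0. Qed.

Lemma mean_fin f : intg f -> (\int[P]_o (f o)%:E = (mean f)%:E)%E.
Proof. by move=> If; rewrite /mean /Rintegral fineK//; exact: integrable_fin_num. Qed.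

Lemma mean_le_integral f g : intg f -> intg g ->
  (\int[P]_o (f o)%:E <= \int[P]_o (g o)%:E)%E -> mean f <= mean g.
Proof. by move=> If Ig; rewrite !mean_fin// lee_fin. Qed.

(** Monotone convergence: the sum, taken in the extended reals, has as integral the finite sum of
    the means, so it is finite almost everywhere. This does the work of a supermartingale
    theorem. *)
Lemma ae_cvg_series (f : nat -> Omega -> R) :
  (forall k o, 0 <= f k o) -> (forall k, intg (f k)) ->
  cvgn (series (fun k => mean (f k))) ->
  {ae P, forall o, cvgn (series (fun k => f k o))}.
Proof.
move=> f0 If cf.
have mf k : measurable_fun setT (EFin \o f k) by case/integrableP : (If k).
have fE k o : setT o -> (0 <= (EFin \o f k) o)%E by rewrite /= lee_fin.
pose S o := (\sum_(0 <= k <oo) (f k o)%:E)%E.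
have iS : P.-integrable setT S.
  apply/integrableP; split.
    by apply: ge0_emeasurable_sum => [k o _ _|k _]; [rewrite lee_fin|exact: mf].
  rewrite (eq_integral S); last first.
    by move=> o _; rewrite gee0_abs// nneseries_ge0// => k _ _; rewrite lee_fin.
  rewrite integral_nneseries//.
  have [M MS] := cvg_series_ge _ (fun k => mean_ge0 _ (f0 k)) cf.
  apply: le_lt_trans (ltry M); apply: lime_le.
    by apply: is_cvg_nneseries => k _ _; apply: integral_ge0 => o _; rewrite lee_fin.
  near=> n; under eq_bigr do rewrite mean_fin//.
  by rewrite sumEFin lee_fin; exact: MS.
have := integrable_ae measurableT iS; apply: filterS => o /(_ I) fin.
apply: nondecreasing_is_cvgn; first exact: nondecreasing_series.
exists (fine (S o)) => _ [n _ <-].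
rewrite -lee_fin fineK// /series/= -sumEFin.
by apply: nneseries_lim_ge => k _ _; rewrite lee_fin.
Unshelve. all: by end_near. Qed.

Lemma ae_cvg_weighted (a : nat -> R) (f : nat -> Omega -> R) :
  (forall k, 0 <= a k) -> (forall k o, 0 <= f k o) -> (forall k, intg (f k)) ->
  cvgn (series (fun k => a k * mean (f k))) ->
  {ae P, forall o, cvgn (series (fun k => a k * f k o))}.
Proof.
move=> a0 f0 If cf; apply: ae_cvg_series => [k o|k|].
- exact: mulr_ge0.
- exact: intgZ.
- rewrite (_ : (fun k => mean _) = (fun k => a k * mean (f k)))//.
  by apply/funext => k; exact: meanZ.
Qed.

Definition sqint U : Prop := measurable_vec U /\ intg (fun o => nrm2 (U o)).

Lemma sqint_dom U g : measurable_vec U -> (forall o, nrm2 (U o) <= g o) ->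
  intg g -> sqint U.
Proof.
move=> mU Ug ig; split=> //; apply: intg_dom ig; first exact: measurable_dotv.
by move=> o; rewrite ger0_norm// nrm2_ge0.
Qed.

Lemma sqint_cst u : sqint (fun=> u).
Proof. by split; [exact: measurable_vec_cst|exact: intg_cst]. Qed.

Lemma sqintD U V : sqint U -> sqint V -> sqint (fun o => U o + V o).
Proof.
move=> [mU iU] [mV iV]; apply: sqint_dom (intgD _ _ (intgZ 2 _ iU) (intgZ 2 _ iV)).
  exact: measurable_vecD.
by move=> o; exact: nrm2D_le.
Qed.

Lemma sqintZ a U : sqint U -> sqint (fun o => a *: U o).
Proof.
move=> [mU iU]; apply: sqint_dom (intgZ (a ^+ 2) _ iU).
  exact: measurable_vecZ.
by move=> o; rewrite nrm2Z.
Qed.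

Lemma sqintB U V : sqint U -> sqint V -> sqint (fun o => U o - V o).
Proof.
move=> sU sV; under eq_fun do rewrite -scaleN1r.
by apply: sqintD => //; exact: sqintZ.
Qed.

Lemma sqint_lipschitz (G : 'rV[R]_p -> 'rV[R]_p) L U :
  (forall y y', nrm2 (G y - G y') <= L ^+ 2 * nrm2 (y - y')) ->
  sqint U -> sqint (fun o => G (U o)).
Proof.
move=> lipG sU; have [mU _] := sU.
have sG : sqint (fun o => G (U o) - G 0).
  have [_ i0] := sqintB _ _ sU (sqint_cst 0).
  apply: sqint_dom (intgZ (L ^+ 2) _ i0) => //.
  apply: measurable_vecB (measurable_vec_cst _).
  exact: measurable_fun_lipschitz_comp lipG mU.
have := sqintD _ _ sG (sqint_cst (G 0)).
by under eq_fun do rewrite subrK.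
Qed.

Lemma intg_dotv U V : sqint U -> sqint V -> intg (fun o => dotv (U o) (V o)).
Proof.
move=> [mU iU] [mV iV]; apply: intg_dom (intgD _ _ iU iV).
  exact: measurable_dotv.
move=> o; have h := ltr01 : 0 < 1 :> R.
have := dotv_young _ (U o) (V o) h; have := dotv_youngN _ (U o) (V o) h.
have := nrm2_ge0 (U o); have := nrm2_ge0 (V o).
by rewrite ler_norml => *; apply/andP; split; lra.
Qed.

End SquareIntegrable.

(** * The Lyapunov inequality in expectation *)

(** The arithmetic of [mean_descent]: [P] is the Lyapunov mean, [E] the shift error, [N'] the
    estimator error, [D] the mean of [Dm], [X'] the new lag, and [X] the old lag times
    [Theta * L ^+ 2]. In [11], ten units pay the error of the descent and one keeps
    [eta * (t2 * N')] on the left. *)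
Lemma descent_algebra {R : realType}
    (eta t2 t2' tg wD wX kp C g q P P' E E' X X' N' D D' W dl : R) :
  0 < eta -> 0 < t2 -> 0 < tg -> 0 <= kp -> kp <= 1 -> 0 <= wD -> 0 <= wX ->
  0 <= C -> 0 <= E -> 0 <= X -> 0 <= D -> 0 <= X' -> 0 <= D' ->
  wD * (1 - kp * tg) = 11 -> t2' <= tg * t2 ->
  P' + 2 * eta * t2' * E' + (1 / 10 - q) / eta * (t2 * X') + g * W <=
    (1 + C) * P + 2 * eta * t2 * E + 10 * eta * t2 * N' ->
  N' <= D' -> D' <= kp * D + X + dl / t2 ->
  P' + 2 * eta * t2' * E' + wD * eta * t2' * D' + wX / eta * t2' * X'
  + ((1 / 10 - q - wX * tg) / eta * (t2 * X') + (g * W + eta * (t2 * N'))) <=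
  (1 + C) * (P + 2 * eta * t2 * E + wD * eta * t2 * D
             + (11 + wD * tg) * eta * t2 * X)
  + (11 + wD * tg) * eta * dl.
Proof.
move=> e0 t0 g0 k0 k1 w0 x0 C0 E0 X0 D0 X'0 D'0 wE t' descent ND Dle.
have et : 0 <= eta * t2 by rewrite mulr_ge0// ltW.
have b0 : 0 <= 11 + wD * tg by apply: addr_ge0 => //; exact: mulr_ge0 (ltW g0).
have h1 : wD * eta * t2' * D' <= wD * eta * (tg * t2) * D'.
  apply: ler_wpM2r => //; apply: ler_wpM2l => //; exact: mulr_ge0 (ltW e0).
have h2 : wX / eta * t2' * X' <= wX / eta * (tg * t2) * X'.
  apply: ler_wpM2r => //; apply: ler_wpM2l => //; exact: divr_ge0 (ltW e0).
have h3 := ler_wpM2l et ND.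
have h4 : (11 + wD * tg) * (eta * t2) * D' <=
    (11 + wD * tg) * (eta * t2) * (kp * D + X + dl / t2).
  by apply: ler_wpM2l => //; exact: mulr_ge0.
have h5 : (11 + wD * tg) * kp * (eta * t2 * D) <= wD * (eta * t2 * D).
  apply: ler_wpM2r; first exact: mulr_ge0.
  move: wE k1; clear; lra.
have h7 : (11 + wD * tg) * (eta * t2) * (dl / t2) = (11 + wD * tg) * eta * dl.
  by field; rewrite gt_eqF.
have h8 : 0 <= C * (2 * eta * t2 * E + wD * eta * t2 * D + (11 + wD * tg) * eta * t2 * X).
  apply: mulr_ge0 => //; apply: addr_ge0; first apply: addr_ge0.
  - by rewrite -[2 * eta * t2]mulrA; apply: mulr_ge0 => //; exact: mulr_ge0.
  - by rewrite -[wD * eta * t2]mulrA; apply: mulr_ge0 => //; exact: mulr_ge0.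
  - by rewrite -[(11 + wD * tg) * eta * t2]mulrA; apply: mulr_ge0 => //; exact: mulr_ge0.
rewrite mulrDr h7 in h4.
have -> : (1 / 10 - q - wX * tg) / eta * (t2 * X') =
  (1 / 10 - q) / eta * (t2 * X') - wX / eta * (tg * t2) * X' by ring.
move: descent h1 h2 h3 h4 h5 h8; clear.
set c := (1 / 10 - q) / eta; set c1 := wX / eta; set d := (11 + wD * tg) * eta * dl.
clearbody c c1 d; lra.
Qed.

Ltac intg_auto := repeat first [assumption | apply: intgD | apply: intgZ].

Section Process.
Context {d : measure_display} {Omega : measurableType d} {R : realType} {p : nat}.
Variable P : probability Omega R.
Variables (G : 'rV[R]_p -> 'rV[R]_p) (T : 'rV[R]_p -> set 'rV[R]_p).
Variables (L rho s eta kappa Theta : R) (delta : nat -> R).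
Variables (x v z ym Gm : nat -> Omega -> 'rV[R]_p) (Dm : nat -> Omega -> R).

Local Notation Bc := (Bc rho s eta).
Local Notation w k o := (resid G (x ^~ o) (v ^~ o) k).
Local Notation ep k o := (shift_err G (x ^~ o) (Gm ^~ o) k).
Local Notation en k o := (est_err G (ym ^~ o) (Gm ^~ o) k).
Local Notation lag k o := (x k o - ym k o).
Local Notation lyapo xs k o := (lyapk G rho s eta (x ^~ o) (v ^~ o) (z ^~ o) xs k).

Hypothesis adm : admissible s eta Bc rho.
Hypothesis ops : weak_minty_data G T L rho.
Hypothesis run : forall o,
  vfog_path T s eta rho (x ^~ o) (v ^~ o) (z ^~ o) (ym ^~ o) (Gm ^~ o).
Hypothesis ini : exists x0 v0, forall o,
  [/\ x 0%N o = x0, v 0%N o = v0, z 0%N o = x0, ym 0%N o = x0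
    & Gm 0%N o = G x0 /\ Dm 0%N o = 0].
Hypothesis meas : forall k, [/\ measurable_vec (x k), measurable_vec (v k),
  measurable_vec (z k), measurable_vec (Gm k) & measurable_fun setT (Dm k)].
Hypothesis Dm0 : forall k o, 0 <= Dm k o.
Hypothesis eb1 : forall k,
  (\int[P]_o (nrm2 (en k.+1 o))%:E <= \int[P]_o (Dm k.+1 o)%:E)%E.
Hypothesis eb2 : forall k, (\int[P]_o (Dm k.+1 o)%:E <=
  \int[P]_o ((1 - kappa) * Dm k o + Theta * L ^+ 2 * nrm2 (lag k o)
             + delta k / tk s k ^+ 2)%:E)%E.
Hypothesis zer : exists xs, zerPhi G T xs.
Hypothesis q16 : 16 * (L * eta) ^+ 2 <= 1.

Let lipG := wm_lip _ _ _ _ ops.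

(** Finiteness propagates in the order of the algorithm: [z] and [ym] combine earlier iterates; (EB)
    bounds [Dm], then the estimator error, hence [Gm]; only then does [path_crude] bound the
    implicit [x] and the residual, from which [v] follows. *)
Lemma sqint_iterates k :
  [/\ sqint P (x k), sqint P (v k), sqint P (z k), sqint P (ym k) & sqint P (Gm k)]
  /\ intg P (Dm k).
Proof.
elim: k => [|k [[sx sv sz sy sG] iD]].
  have [x0 [v0 h]] := ini.
  have c (u : 'rV[R]_p) (U : Omega -> 'rV[R]_p) : (forall o, U o = u) -> sqint P U.
    by move=> Uu; rewrite (_ : U = fun=> u); [exact: sqint_cst|apply/funext].
  split; last first.
    rewrite (_ : Dm 0 = fun=> 0); first exact: intg_cst.
    by apply/funext => o; case: (h o) => _ _ _ _ [].
  by split; [apply: (c x0 (x 0))|apply: (c v0 (v 0))|apply: (c x0 (z 0))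
    |apply: (c x0 (ym 0))|apply: (c (G x0) (Gm 0))] => o; case: (h o) => ? ? ? ? [].
have swt : sqint P (fun o => Gm k o + v k o) by exact: sqintD.
have sxh : sqint P (fun o => xhat s k (x k o) (z k o)).
  by apply: sqintD; exact: sqintZ.
have sz' : sqint P (z k.+1).
  rewrite (_ : z k.+1 = fun o => z k o - (gammak s eta k / s) *: (Gm k o + v k o)).
    by apply: sqintB => //; exact: sqintZ.
  by apply/funext => o; exact: path_z (run o) k.
have sy' : sqint P (ym k.+1).
  rewrite (_ : ym k.+1 = fun o => xhat s k (x k o) (z k o)
    - (eta - betak s eta rho k) *: (Gm k o + v k o)).
    by apply: sqintB => //; exact: sqintZ.
  by apply/funext => o; exact: path_y (run o) k.
have [mx' mv' _ mG' mD'] := meas k.+1.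
have iD' : intg P (Dm k.+1).
  apply: intg_le (eb2 k) => //; apply: intgD; last exact: intg_cst.
  apply: intgD; first exact: intgZ.
  by apply: intgZ; have [] := sqintB _ _ _ sx sy.
have mGy : measurable_vec (fun o => G (ym k.+1 o)).
  by case: sy' => + _; exact: measurable_fun_lipschitz_comp.
have men : measurable_vec (fun o => en k.+1 o) by exact: measurable_vecB.
have sen : sqint P (fun o => en k.+1 o).
  split=> //; apply: intg_le (eb1 k) => //; last by move=> o; exact: nrm2_ge0.
  exact: measurable_dotv.
have sG' : sqint P (Gm k.+1).
  rewrite (_ : Gm k.+1 = fun o => en k.+1 o + G (ym k.+1 o)).
    by apply: sqintD => //; exact: sqint_lipschitz lipG sy'.
  by apply/funext => o; rewrite /est_err subrK.
have [xs zx] := zer.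
pose bnd o := 2 * nrm2 (xhat s k (x k o) (z k o) - xs
    + betak s eta rho k *: (Gm k o + v k o))
  + 4 * eta ^+ 2 * nrm2 (en k.+1 o) + nrm2 (ym k.+1 o - xs).
have ibnd : intg P bnd.
  apply: intgD; first apply: intgD.
  - apply: intgZ; apply: (proj2 (sqintD _ _ _ _ _)); last exact: sqintZ.
    exact: sqintB (sqint_cst _ _).
  - by apply: intgZ; case: sen.
  - by apply: (proj2 (sqintB _ _ _ _ _)) => //; exact: sqint_cst.
have crude o : nrm2 (x k.+1 o - xs) / 2 + eta ^+ 2 / 5 * nrm2 (w k.+1 o) <= bnd o.
  exact: (path_crude _ _ _ _ _ _ _ _ _ _ _ adm ops (run o) xs k zx q16).
have eta0 : 0 < eta := adm_eta _ _ _ _ adm.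
have e20 : 0 < eta ^+ 2 / 5 by rewrite divr_gt0 ?exprn_gt0.
have sx' : sqint P (x k.+1).
  have sxx : sqint P (fun o => x k.+1 o - xs).
    apply: sqint_dom (intgZ _ 2 _ ibnd).
      exact: measurable_vecB (measurable_vec_cst _).
    move=> o; have := crude o; have := mulr_ge0 (ltW e20) (nrm2_ge0 (w k.+1 o)).
    lra.
  by have := sqintD _ _ _ sxx (sqint_cst _ xs); under eq_fun do rewrite subrK.
have sGx' : sqint P (fun o => G (x k.+1 o)) by exact: sqint_lipschitz lipG sx'.
have sw' : sqint P (fun o => w k.+1 o).
  apply: sqint_dom (intgZ _ (eta ^+ 2 / 5)^-1 _ ibnd).
    by apply: measurable_vecD => //; case: sGx'.
  move=> o; rewrite mulrC ler_pdivlMr// mulrC.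
  by have := crude o; have := nrm2_ge0 (x k.+1 o - xs); lra.
split=> //; split=> //.
rewrite (_ : v k.+1 = fun o => w k.+1 o - G (x k.+1 o)); first exact: sqintB.
by apply/funext => o; rewrite /resid addrC addKr.
Qed.

Lemma intg_resid k : intg P (fun o => nrm2 (w k o)).
Proof.
have [[sx sv _ _ _] _] := sqint_iterates k.
by have [] := sqintD _ _ _ (sqint_lipschitz _ _ _ _ lipG sx) sv.
Qed.

Lemma intg_shift_err k : intg P (fun o => nrm2 (ep k o)).
Proof.
have [[sx _ _ _ sG] _] := sqint_iterates k.
by have [] := sqintB _ _ _ sG (sqint_lipschitz _ _ _ _ lipG sx).
Qed.

Lemma intg_est_err k : intg P (fun o => nrm2 (en k o)).
Proof.
have [[_ _ _ sy sG] _] := sqint_iterates k.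
by have [] := sqintB _ _ _ sG (sqint_lipschitz _ _ _ _ lipG sy).
Qed.

Lemma intg_lag k : intg P (fun o => nrm2 (lag k o)).
Proof.
have [[sx _ _ sy _] _] := sqint_iterates k.
by have [] := sqintB _ _ _ sx sy.
Qed.

Lemma intg_lyapk xs k : intg P (fun o => lyapo xs k o).
Proof.
have [[sx sv sz _ _] _] := sqint_iterates k.
have sw : sqint P (fun o => w k o).
  exact: sqintD (sqint_lipschitz _ _ _ _ lipG sx) sv.
apply: intgD; last first.
  by apply: intgZ; have [] := sqintB _ _ _ sz (sqint_cst _ xs).
apply: intgD; apply: intgZ; first exact: intg_resid.
by apply: intg_dotv => //; exact: sqintB.
Qed.

Hypotheses (kappa0 : 0 <= kappa) (kappa1 : kappa <= 1).
Hypothesis Theta0 : 0 <= Theta.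
Hypothesis delta0 : forall k, 0 <= delta k.
Hypothesis sum_delta : cvgn (series delta).

(* [tgrowth] bounds [(t_(k+1) / t_k)^2]. The weight [wD] of [Delta_(k-1)] solves
   [wD = 11 + wD * (1 - kappa) * tgrowth], so that the error recursion closes, and
   [wX] is what it then charges to the lag [|x^k - y^(k-1)|^2]. *)
Definition tgrowth : R := (s + 1) ^+ 2 / s ^+ 2.

Lemma tgrowth_gt0 : 0 < tgrowth.
Proof. by have s7 := adm_s _ _ _ _ adm; rewrite divr_gt0// exprn_gt0//; lra. Qed.

Lemma tk_growth k : tk s k.+1 ^+ 2 <= tgrowth * tk s k ^+ 2.
Proof.
have s7 := adm_s _ _ _ _ adm.
have s0 : 0 < s by lra.
have k0 : 0 <= k%:R :> R by [].
have -> : tgrowth * tk s k ^+ 2 = ((s + 1) / s * tk s k) ^+ 2.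
  by rewrite /tgrowth; field; rewrite gt_eqF.
rewrite /tk -natr1 ler_pXn2r ?nnegrE//.
- by rewrite mulrAC ler_pdivlMr//; lra.
- lra.
- by rewrite mulr_ge0// ?divr_ge0//; lra.
Qed.

Definition wD : R := 11 / (1 - (1 - kappa) * tgrowth).
Definition wX : R := (11 + wD * tgrowth) * (Theta * (L * eta) ^+ 2).

Hypothesis contr : (1 - kappa) * tgrowth < 1.
Hypothesis budget : 10 * (L * eta) ^+ 2 + wX * tgrowth < 1 / 10.

(** Each error leaves a memory term: the shift error handed on by the descent, and [Dm] and the lag,
    on which the next [Dm] depends. *)
Definition mean_lyap xs k : R := mean P (fun o => lyapo xs k o)
  + 2 * eta * tk s k ^+ 2 * mean P (fun o => nrm2 (ep k o))
  + wD * eta * tk s k ^+ 2 * mean P (Dm k)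
  + wX / eta * tk s k ^+ 2 * mean P (fun o => nrm2 (lag k o)).

Definition slack : R := (1 / 10 - 10 * (L * eta) ^+ 2 - wX * tgrowth) / eta.

Lemma mean_descent xs k : zerPhi G T xs -> 19 * s <= k%:R + 1 ->
  mean_lyap xs k.+1
  + (slack * (tk s k ^+ 2 * mean P (fun o => nrm2 (lag k.+1 o)))
     + (eta / (4 * (s - 2)) * ((k%:R + 1) * mean P (fun o => nrm2 (w k o)))
     + eta * (tk s k ^+ 2 * mean P (fun o => nrm2 (en k.+1 o)))))
  <= (1 + gronwall_const rho s eta / tk s k ^+ 2) * mean_lyap xs k
     + (11 + wD * tgrowth) * eta * delta k.
Proof.
move=> zx k19.
have eta0 : 0 < eta := adm_eta _ _ _ _ adm.
have s7 : 7 < s := adm_s _ _ _ _ adm.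
have s0 : 0 < s by lra.
have t0 : 0 < tk s k := tk_gt0 _ _ s0.
have [[iP iE] iW] := (intg_lyapk xs k, intg_shift_err k, intg_resid k).
have [iP' iE'] := (intg_lyapk xs k.+1, intg_shift_err k.+1).
have [[iX iX'] iN'] := (intg_lag k, intg_lag k.+1, intg_est_err k.+1).
have [_ iD] := sqint_iterates k; have [_ iD'] := sqint_iterates k.+1.
have descent : mean P (fun o => lyapo xs k.+1 o
    + 2 * eta * tk s k.+1 ^+ 2 * nrm2 (ep k.+1 o)
    + (1 / 10 - 10 * (L * eta) ^+ 2) / eta * (tk s k ^+ 2 * nrm2 (lag k.+1 o))
    + eta / (4 * (s - 2)) * ((k%:R + 1) * nrm2 (w k o))) <=
  mean P (fun o => (1 + gronwall_const rho s eta / tk s k ^+ 2) * lyapo xs k o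
    + 2 * eta * tk s k ^+ 2 * nrm2 (ep k o)
    + 10 * eta * tk s k ^+ 2 * nrm2 (en k.+1 o)).
  apply: mean_le => [||o].
  - by intg_auto.
  - by intg_auto.
  exact: (path_descent _ _ _ _ _ _ _ _ _ _ _ adm ops (run o) xs k zx k19).
rewrite (mean_lin4 _ _ _ _ _ _ _ _ iP' iE' (intgZ _ _ _ iX') (intgZ _ _ _ iW)) in descent.
rewrite (mean_lin3 _ _ _ _ _ _ _ iP iE iN') in descent.
rewrite (meanZ _ _ _ iX') (meanZ _ _ _ iW) in descent.
have n_le : mean P (fun o => nrm2 (en k.+1 o)) <= mean P (Dm k.+1).
  exact: mean_le_integral (eb1 k).
have d_le : mean P (Dm k.+1) <= (1 - kappa) * mean P (Dm k)
    + Theta * L ^+ 2 * mean P (fun o => nrm2 (lag k o)) + delta k / tk s k ^+ 2.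
  have iR : intg P (fun o => (1 - kappa) * Dm k o + Theta * L ^+ 2 * nrm2 (lag k o)
             + delta k / tk s k ^+ 2).
    by apply: intgD; [apply: intgD; exact: intgZ|exact: intg_cst].
  have := mean_le_integral _ _ _ iD' iR (eb2 k).
  rewrite meanD; [|by apply: intgD; exact: intgZ|exact: intg_cst].
  by rewrite meanD ?mean_cst ?meanZ//; exact: (intgZ _ _ _ iX) || exact: (intgZ _ _ _ iD).
have P0 : 0 <= mean P (fun o => lyapo xs k o).
  by apply: mean_ge0 => o; exact: (lyapk_ge0 _ _ _ _ _ _ _ _ _ _ _ adm ops (run o)).
have E0 : 0 <= mean P (fun o => nrm2 (ep k o)) by apply: mean_ge0 => o; exact: nrm2_ge0.
have D0 : 0 <= mean P (Dm k) by apply: mean_ge0 => o; exact: Dm0.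
have X0 : 0 <= mean P (fun o => nrm2 (lag k o)) by apply: mean_ge0 => o; exact: nrm2_ge0.
have D'0 : 0 <= mean P (Dm k.+1) by apply: mean_ge0 => o; exact: Dm0.
have X'0 : 0 <= mean P (fun o => nrm2 (lag k.+1 o)) by apply: mean_ge0 => o; exact: nrm2_ge0.
have C0 : 0 <= gronwall_const rho s eta / tk s k ^+ 2.
  by apply: divr_ge0; [exact: gronwall_const_ge0 adm|exact: sqr_ge0].
have g0 := tgrowth_gt0.
have tle := tk_growth k.
have k0 : 0 <= 1 - kappa by rewrite subr_ge0.
have k1 : 1 - kappa <= 1 by rewrite gerBl.
have r0 : 0 < 1 - (1 - kappa) * tgrowth by rewrite subr_gt0.
have wDE : wD * (1 - (1 - kappa) * tgrowth) = 11 by rewrite /wD divfK// gt_eqF.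
have wD0 : 0 <= wD by exact: divr_ge0 (ltW r0).
have wX0 : 0 <= wX.
  rewrite /wX; apply: mulr_ge0; last by apply: mulr_ge0 => //; exact: sqr_ge0.
  by apply: addr_ge0 => //; apply: mulr_ge0 (ltW g0).
have t20 : 0 < tk s k ^+ 2 by rewrite exprn_gt0.
rewrite /mean_lyap /slack.
(* Unfolding [wX] exhibits the old lag with the weight that the (EB) recursion charges to it. *)
have -> : wX / eta * tk s k ^+ 2 * mean P (fun o => nrm2 (lag k o)) =
   (11 + wD * tgrowth) * eta * tk s k ^+ 2 *
   (Theta * L ^+ 2 * mean P (fun o => nrm2 (lag k o))).
  by rewrite /wX; field; rewrite gt_eqF.
have TX0 : 0 <= Theta * L ^+ 2 * mean P (fun o => nrm2 (lag k o)).
  by apply: mulr_ge0 => //; apply: mulr_ge0 => //; exact: sqr_ge0.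
by have := descent_algebra _ _ _ _ _ _ _ _ _ _ _ _ _ _ _ _ _ _ _ _ _ _ _ _ _ _ _ _ _ _ _ _ _ _ _ _ descent n_le d_le; apply.
Qed.

Lemma sum_means : [/\
  cvgn (series (fun k => (k%:R + 1) * mean P (fun o => nrm2 (w k o)))),
  cvgn (series (fun k => tk s k ^+ 2 * mean P (fun o => nrm2 (en k.+1 o)))) &
  cvgn (series (fun k => tk s k ^+ 2 * mean P (fun o => nrm2 (lag k.+1 o))))].
Proof.
have [xs zx] := zer.
have eta0 : 0 < eta := adm_eta _ _ _ _ adm.
have s7 : 7 < s := adm_s _ _ _ _ adm.
have s0 : 0 < s by lra.
(* Beyond [N] the descent applies; the earlier terms are finite and do not affect convergence of the
   series. *)
pose N := Num.bound (19 * s).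
have kN k : 19 * s <= (k + N)%:R + 1.
  have : 19 * s < N%:R by rewrite /N archi_boundP//; lra.
  by rewrite natrD; have : 0 <= k%:R :> R by []; lra.
have n0 (f : Omega -> 'rV[R]_p) : 0 <= mean P (fun o => nrm2 (f o)).
  by apply: mean_ge0 => o; exact: nrm2_ge0.
have D0 k : 0 <= mean P (Dm k) by apply: mean_ge0.
pose a k := slack * (tk s k ^+ 2 * mean P (fun o => nrm2 (lag k.+1 o))).
pose b k := eta / (4 * (s - 2)) * ((k%:R + 1) * mean P (fun o => nrm2 (w k o))).
pose c k := eta * (tk s k ^+ 2 * mean P (fun o => nrm2 (en k.+1 o))).
have sl0 : 0 < slack by rewrite divr_gt0//; have := budget; lra.
have g0 : 0 < eta / (4 * (s - 2)) by rewrite divr_gt0//; lra.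
have a0 k : 0 <= a k by rewrite /a mulr_ge0 ?(ltW sl0)// mulr_ge0 ?sqr_ge0.
have b0 k : 0 <= b k by rewrite /b mulr_ge0 ?(ltW g0)// mulr_ge0// addr_ge0.
have c0 k : 0 <= c k by rewrite /c mulr_ge0 ?(ltW eta0)// mulr_ge0 ?sqr_ge0.
have tg0 : 0 <= tgrowth by rewrite divr_ge0 ?sqr_ge0.
have wD0 : 0 <= wD by apply: divr_ge0 => //; have := contr; lra.
have b110 : 0 <= 11 + wD * tgrowth by rewrite addr_ge0// mulr_ge0.
have wX0 : 0 <= wX by rewrite /wX mulr_ge0// mulr_ge0 ?sqr_ge0.
have lyap0 k : 0 <= mean_lyap xs k.
  rewrite /mean_lyap; have e0 := ltW eta0; have t2 := sqr_ge0 (tk s k).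
  apply: addr_ge0; [apply: addr_ge0; [apply: addr_ge0|]|].
  - by apply: mean_ge0 => o; exact: (lyapk_ge0 _ _ _ _ _ _ _ _ _ _ _ adm ops (run o)).
  - by apply: mulr_ge0 => //; apply: mulr_ge0 => //; exact: mulr_ge0.
  - by apply: mulr_ge0 => //; apply: mulr_ge0 => //; exact: mulr_ge0.
  - by apply: mulr_ge0 => //; apply: mulr_ge0 => //; exact: divr_ge0.
have cb : cvgn (series (fun k => gronwall_const rho s eta / tk s (k + N) ^+ 2)).
  rewrite (is_cvg_series_shift (fun k => gronwall_const rho s eta / tk s k ^+ 2)).
  exact/is_cvg_seriesM/series_inv_sqr_tk.
have cd : cvgn (series (fun k => (11 + wD * tgrowth) * eta * delta (k + N)%N)).
  rewrite (is_cvg_series_shift (fun k => (11 + wD * tgrowth) * eta * delta k)).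
  exact: is_cvg_seriesM.
have [||||_] := fejer_cvg (fun k => mean_lyap xs (k + N)%N)
  (fun k => a (k + N)%N + (b (k + N)%N + c (k + N)%N)) _ _ (fun k => lyap0 (k + N)%N) _ _ _ _ cb cd.
- by move=> k; rewrite !addr_ge0.
- by move=> k; rewrite divr_ge0 ?sqr_ge0//; exact: gronwall_const_ge0 adm.
- by move=> k; rewrite mulr_ge0// mulr_ge0// ltW.
- by move=> k; exact: mean_descent.
rewrite (is_cvg_series_shift (fun k => a k + (b k + c k))) => cabc.
split.
- apply: (@series_dominated _ _ _ (eta / (4 * (s - 2)))^-1 _ _ cabc) => k.
    by rewrite mulr_ge0// addr_ge0.
  rewrite ler_pdivlMl// -/(b k).
  by have := a0 k; have := c0 k; lra.
- apply: (@series_dominated _ _ _ eta^-1 _ _ cabc) => k; first by rewrite mulr_ge0 ?sqr_ge0.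
  rewrite ler_pdivlMl// -/(c k).
  by have := a0 k; have := b0 k; lra.
- apply: (@series_dominated _ _ _ slack^-1 _ _ cabc) => k; first by rewrite mulr_ge0 ?sqr_ge0.
  rewrite ler_pdivlMl// -/(a k).
  by have := b0 k; have := c0 k; lra.
Qed.

Lemma ae_sums : {ae P, forall o, [/\
  cvgn (series (fun k => (k%:R + 1) * nrm2 (w k o))),
  cvgn (series (fun k => tk s k ^+ 2 * nrm2 (en k.+1 o))) &
  cvgn (series (fun k => tk s k ^+ 2 * nrm2 (lag k.+1 o)))]}.
Proof.
have [c1 c2 c3] := sum_means.
have a0 k : 0 <= k%:R + 1 :> R by rewrite addr_ge0.
have t0 k : 0 <= tk s k ^+ 2 by exact: sqr_ge0.
have h1 := ae_cvg_weighted P (fun k => k%:R + 1) (fun k o => nrm2 (w k o))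
  a0 (fun k o => nrm2_ge0 _) intg_resid c1.
have h2 := ae_cvg_weighted P (fun k => tk s k ^+ 2) (fun k o => nrm2 (en k.+1 o))
  t0 (fun k o => nrm2_ge0 _) (fun k => intg_est_err k.+1) c2.
have h3 := ae_cvg_weighted P (fun k => tk s k ^+ 2) (fun k o => nrm2 (lag k.+1 o))
  t0 (fun k o => nrm2_ge0 _) (fun k => intg_lag k.+1) c3.
by move: h1 h2 h3; apply: filterS3 => o g1 g2 g3; split.
Qed.


End Process.

(** * The constants *)

Section Constants.
Context {R : realType}.
Variables (s kappa Theta L eta rho : R).

(** The lower bound on [eta] is exactly [Bc <= eta]. The [2 * rho] in [Bc] cancels [rho] in
    [adm_gap], where [(s - 2) / (4 * (s - 1)) >= 1 / 5] gives [3 / 5]. The strict inequality leaves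
    [5 * eta / 4] in [adm_drop], the excess of [3 s^2 - 8 s + 4] over [3 s^2 - 8 s - 1]. *)
Lemma vfog_admissible : 7 < s -> 0 <= rho ->
  8 * (s - 1) * rho / (3 * s - 2) <= eta ->
  8 * (s - 1) * (s - 2) * rho < (3 * s ^+ 2 - 8 * s - 1) * eta ->
  admissible s eta (Bc rho s eta) rho.
Proof.
move=> s7 rho0 h1 h2.
have s1 : 0 < s - 1 by lra.
have s2 : 0 < s - 2 by lra.
have s3 : 0 < 3 * s - 2 by lra.
have sN1 : s - 1 != 0 by rewrite gt_eqF.
have eta0 : 0 < eta.
  have : 0 < (3 * s ^+ 2 - 8 * s - 1) * eta.
    by apply: le_lt_trans h2; rewrite !mulr_ge0// ltW.
  rewrite pmulr_rgt0//.
  have : 0 < (s - 7) * (3 * s + 13) by rewrite mulr_gt0//; lra.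
  lra.
have {}h1 : 8 * (s - 1) * rho <= eta * (3 * s - 2) by rewrite -ler_pdivrMr.
have rho2 : 2 * rho <= eta * ((3 * s - 2) / (4 * (s - 1))).
  rewrite mulrA ler_pdivlMr ?mulr_gt0//; lra.
have BE : Bc rho s eta = eta * ((s - 2) / (4 * (s - 1))) + 2 * rho.
  by rewrite /Bc; field.
have sum1 : eta * ((s - 2) / (4 * (s - 1))) + eta * ((3 * s - 2) / (4 * (s - 1))) = eta.
  by field.
have c0 : 0 <= eta * ((s - 2) / (4 * (s - 1))).
  by rewrite mulr_ge0 ?divr_ge0 ?mulr_ge0// ltW.
have c1 : 1 / 5 * eta <= eta * ((s - 2) / (4 * (s - 1))).
  by rewrite mulrC ler_pM2l// ler_pdivlMr ?mulr_gt0//; lra.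
split=> //.
- by rewrite BE addr_ge0// mulr_ge0.
- by rewrite BE; lra.
- lra.
- by rewrite BE; lra.
- have -> : (s - 1) * (s - 2) * (eta - Bc rho s eta) =
    ((3 * s ^+ 2 - 8 * s + 4) * eta - 8 * (s - 1) * (s - 2) * rho) / 4.
    by rewrite /Bc; field.
  lra.
Qed.

Lemma vfog_contraction : 7 < s -> (2 * s + 1) / (s + 1) ^+ 2 < kappa ->
  (1 - kappa) * tgrowth s < 1.
Proof.
move=> s7; have s10 : 0 < (s + 1) ^+ 2 by rewrite exprn_gt0//; lra.
have s0 : 0 < s ^+ 2 by rewrite exprn_gt0//; lra.
rewrite ltr_pdivrMr// => h.
have -> : (1 - kappa) * tgrowth s = (1 - kappa) * (s + 1) ^+ 2 / s ^+ 2.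
  by rewrite /tgrowth mulrA.
rewrite ltr_pdivrMr// mul1r.
have : (s + 1) ^+ 2 = s ^+ 2 + 2 * s + 1 by ring.
lra.
Qed.

(* The step-size restriction [eta < lambda / L] is used through
   [384 (L eta)^2 + 512 theta < 1], where [theta] is the total weight that the
   error recursion puts on the lag terms. *)
Lemma vfog_step_bound : 7 < s -> (2 * s + 1) / (s + 1) ^+ 2 < kappa ->
  kappa <= 1 -> 0 <= Theta -> 0 < L -> 0 < eta ->
  eta < lambdaC s kappa Theta / L ->
  384 * (L * eta) ^+ 2 + 512 * (Theta * (L * eta) ^+ 2 * tgrowth s
    / (1 - (1 - kappa) * tgrowth s)) < 1.
Proof.
move=> s7 kap kappa1 Th0 L0 eta0 step.
have contr := vfog_contraction s7 kap.
have s0 : 0 < s by lra.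
have s2 : 0 < s - 2 by lra.
have r0 : 0 < 1 - (1 - kappa) * tgrowth s by rewrite subr_gt0.
have tg0 : 0 < tgrowth s by rewrite /tgrowth divr_gt0 ?exprn_gt0//; lra.
set om := omegaC s kappa Theta.
set th := Theta * tgrowth s / (1 - (1 - kappa) * tgrowth s).
have th0 : 0 <= th by rewrite /th divr_ge0 ?(ltW r0)// mulr_ge0// ltW.
(* The denominator of [Lambda0] contains the same contraction gap as [wD], so the last term of
   [omegaC] is a multiple of [th]. *)
have L0E : Lambda0 s kappa * Theta * (s + 1) ^+ 2 / s ^+ 2 = (16 * s - 18) / (s - 2) * th.
  have sk : s ^+ 2 - (1 - kappa) * (s + 1) ^+ 2 = s ^+ 2 * (1 - (1 - kappa) * tgrowth s).
    by rewrite /tgrowth; field; rewrite gt_eqF.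
  rewrite /Lambda0 sk /th; move: r0; rewrite /tgrowth => r0.
  set q := 1 - (1 - kappa) * _ in r0 *.
  by field; rewrite !gt_eqF.
have om_ge : 23 + 32 * th <= om.
  have e1 : om = 1 + 2 * (11 * s - 13) / (s - 2) + 2 * ((16 * s - 18) / (s - 2) * th).
    by rewrite -L0E /om /omegaC; congr (_ + _); ring.
  have c1 : 22 <= 2 * (11 * s - 13) / (s - 2) by rewrite ler_pdivlMr//; lra.
  have c2 : 16 <= (16 * s - 18) / (s - 2) by rewrite ler_pdivlMr//; lra.
  have := ler_wpM2r th0 c2; rewrite e1; lra.
(* With [s + 1 >= 8], the constants are [384 = 2 * 24 * 8] and [512 = 2 * 32 * 8]. *)
set A := 2 * (1 + om) * (s + 1).
have A_ge : 384 + 512 * th <= A.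
  have : (2 * (24 + 32 * th)) * 8 <= A.
    by apply: ler_pM => //; lra.
  lra.
have A0 : 0 < A by lra.
have q0 : 0 <= L * eta by rewrite mulr_ge0// ltW.
have qA : (L * eta) ^+ 2 * A < 1.
  have : L * eta < 1 / Num.sqrt A.
    by rewrite mulrC -ltr_pdivlMr.
  rewrite ltr_pdivlMr ?sqrtr_gt0// => h.
  have -> : (L * eta) ^+ 2 * A = (L * eta * Num.sqrt A) ^+ 2.
    by rewrite [RHS]exprMn sqr_sqrtr// ltW.
  rewrite expr_lt1// mulr_ge0// sqrtr_ge0//.
have h := ler_wpM2l (sqr_ge0 (L * eta)) A_ge.
have -> : Theta * (L * eta) ^+ 2 * tgrowth s / (1 - (1 - kappa) * tgrowth s) =
   (L * eta) ^+ 2 * th by rewrite /th; ring.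
lra.
Qed.

(** The charge [wX * tgrowth] equals [11 * (r + tgrowth)] times [th], and [r <= tgrowth <= 64 / 49]
    as [s > 7]. The resulting factor is below [29], while a tenth of the step bound allows
    [51.2]. *)
Lemma vfog_budget : 7 < s -> (2 * s + 1) / (s + 1) ^+ 2 < kappa ->
  kappa <= 1 -> 0 <= Theta -> 0 < L -> 0 < eta ->
  eta < lambdaC s kappa Theta / L ->
  16 * (L * eta) ^+ 2 <= 1 /\
  10 * (L * eta) ^+ 2 + wX L s eta kappa Theta * tgrowth s < 1 / 10.
Proof.
move=> s7 kap kappa1 Th0 L0 eta0 step.
have contr := vfog_contraction s7 kap.
have s0 : 0 < s by lra.
have r0 : 0 < 1 - (1 - kappa) * tgrowth s by rewrite subr_gt0.
have := vfog_step_bound s7 kap kappa1 Th0 L0 eta0 step.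
have tg0 : 0 < tgrowth s by rewrite /tgrowth divr_gt0 ?exprn_gt0//; lra.
have tg1 : 1 <= tgrowth s.
  by rewrite /tgrowth ler_pdivlMr ?exprn_gt0// mul1r ler_pXn2r ?nnegrE//; lra.
have tg2 : tgrowth s <= 64 / 49.
  have -> : tgrowth s = ((s + 1) / s) ^+ 2 by rewrite expr_div_n.
  have -> : 64 / 49 = (8 / 7) ^+ 2 :> R by field.
  rewrite ler_pXn2r ?nnegrE ?divr_ge0//; try lra.
  by rewrite ler_pdivrMr//; lra.
set r := 1 - (1 - kappa) * tgrowth s in r0 *.
have rtg : r <= tgrowth s.
  by have := mulr_ge0 (_ : 0 <= 1 - kappa) (ltW tg0); rewrite subr_ge0 /r => /(_ kappa1); lra.
set th := Theta * _ * _ / _ => h.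
have q2 := sqr_ge0 (L * eta).
have th0 : 0 <= th.
  by rewrite /th divr_ge0 ?(ltW r0)// mulr_ge0 ?(ltW tg0)// mulr_ge0.
split; first lra.
have wE : wX L s eta kappa Theta * tgrowth s = 11 * (r + tgrowth s) * th.
  by rewrite /wX /wD -/r /th; field; rewrite gt_eqF.
have : 11 * (r + tgrowth s) * th <= 11 * (64 / 49 + 64 / 49) * th.
  by rewrite ler_wpM2r// ler_wpM2l//; lra.
by rewrite wE; lra.
Qed.

End Constants.

(* Sequences are indexed so that  x k = x^k, v k = v^k, z k = z^k, and the
   lagged sequences  ym k = y^{k-1},  Gm k = tilde G y^{k-1},  Dm k = Delta_{k-1}
   (so ym 0 = x^0, Gm 0 = G x^0, Dm 0 = 0, and y^k = ym k.+1). *)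
Theorem theorem2
  (R : realType) (p : nat)
  (* probability space and filtration *)
  (d : measure_display) (Omega : measurableType d) (P : probability Omega R)
  (F : nat -> set (set Omega))
  (* the stochastic oracle: xi with law PX, maps G_xi *)
  (dX : measure_display) (Xi : measurableType dX) (PX : probability Xi R)
  (Gxi : Xi -> 'rV[R]_p -> 'rV[R]_p)
  (* the operators *)
  (G : 'rV[R]_p -> 'rV[R]_p) (T : 'rV[R]_p -> set 'rV[R]_p)
  (* constants *)
  (sigma L rho_n s eta kappa Theta : R) (delta : nat -> R)
  (* iterates *)
  (x0 v0 : 'rV[R]_p)
  (x v z ym Gm : nat -> Omega -> 'rV[R]_p) (Dm : nat -> Omega -> R) :
  (* zer Phi nonempty *)
  (exists xs, zerPhi G T xs) ->
  (* unbiased oracle *)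
  (forall (y : 'rV[R]_p) (i : 'I_p),
      PX.-integrable setT (fun xi => (Gxi xi y ord0 i)%:E) /\
      (\int[PX]_xi (Gxi xi y ord0 i)%:E = (G y ord0 i)%:E)%E) ->
  (* (A0) *)
  0 <= sigma ->
  (forall y : 'rV[R]_p,
      (\int[PX]_xi (nrm2 (Gxi xi y - G y))%:E <= (sigma ^+ 2)%:E)%E) ->
  (* (A1) with alpha = 1 *)
  0 < L ->
  (forall y y' : 'rV[R]_p, nrm2 (G y - G y') <= L ^+ 2 * nrm2 (y - y')) ->
  (* (A3) with rho_c = 0, rho_n >= 0, L rho_n <= mu *)
  0 <= rho_n ->
  (forall y wy y' wy', graPhi G T y wy -> graPhi G T y' wy' ->
      dotv (wy - wy') (y - y') >= - rho_n * nrm2 (wy - wy')) ->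
  L * rho_n <= muC s kappa Theta ->
  (* parameters *)
  7 < s ->
  (2 * s + 1) / (s + 1) ^+ 2 < kappa -> kappa <= 1 ->
  0 <= Theta ->
  8 * (s - 1) * rho_n / (3 * s - 2) <= eta ->
  eta < lambdaC s kappa Theta / L ->
  (3 * s ^+ 2 - 8 * s - 1) * eta > 8 * (s - 1) * (s - 2) * rho_n ->
  (* filtration F_k : sub-sigma-algebras, nondecreasing *)
  (forall k, sigma_algebra setT (F k)) ->
  (forall k, F k `<=` measurable) ->
  (forall k, F k `<=` F k.+1) ->
  (* adaptedness: x^k, v^k, z^k, tilde G y^{k-1}, Delta_{k-1} are F_k-measurable *)
  (forall k, FmeasV (F k) (x k) /\ FmeasV (F k) (v k) /\ FmeasV (F k) (z k)
             /\ FmeasV (F k) (Gm k) /\ Fmeas (F k) (Dm k)) ->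
  (* initialization *)
  T x0 v0 ->
  (forall w, x 0 w = x0 /\ v 0 w = v0 /\ z 0 w = x0 /\ ym 0 w = x0
             /\ Gm 0 w = G x0 /\ Dm 0 w = 0) ->
  (* VFOG iterations, t_k = k + s + 1, gamma_k, beta_k as in Theorem 1 *)
  (forall k w,
      ym k.+1 w = xhat s k (x k w) (z k w)
                  - (eta - betak s eta rho_n k) *: (Gm k w + v k w)) ->
  (forall k w,
      v k.+1 w = eta^-1 *: (xhat s k (x k w) (z k w) - x k.+1 w
                            + betak s eta rho_n k *: (Gm k w + v k w))
                 - Gm k.+1 w) ->
  (forall k w, T (x k.+1 w) (v k.+1 w)) ->
  (forall k w,
      z k.+1 w = z k w - (gammak s eta k / s) *: (Gm k w + v k w)) ->
  (* error bound condition (EB) *)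
  (forall k w, 0 <= Dm k w) ->
  (forall k, 0 <= delta k) ->
  (forall k, cond_le P (F k)
      (fun w => (nrm2 (Gm k.+1 w - G (ym k.+1 w)))%:E)
      (fun w => (Dm k.+1 w)%:E)) ->
  (forall k, cond_le P (F k)
      (fun w => (Dm k.+1 w)%:E)
      (fun w => ((1 - kappa) * Dm k w + Theta * L ^+ 2 * nrm2 (x k w - ym k w)
                 + delta k / tk s k ^+ 2)%:E)) ->
  (* summable delta_k *)
  cvgn (series delta) ->
  (* (a) *)
  ({ae P, forall w,
      cvgn (series (fun k => (k%:R + 1) * nrm2 (G (x k w) + v k w))) /\
      cvgn (series (fun k => (k%:R + s) * nrm2 (G (ym k w) + v k w)))}) /\
  (* (b) *)
  ({ae P, forall w,
      (fun k : nat => k%:R ^+ 2 * nrm2 (G (x k w) + v k w)) @ \oo --> 0 /\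
      (fun k : nat => k%:R ^+ 2 * nrm2 (G (ym k w) + v k w)) @ \oo --> 0}) /\
  (* (c) *)
  (closed [set xw : 'rV[R]_p * 'rV[R]_p | graPhi G T xw.1 xw.2] ->
   exists xstar : Omega -> 'rV[R]_p,
     (forall i : 'I_p, measurable_fun setT (fun w => xstar w ord0 i)) /\
     (forall w, zerPhi G T (xstar w)) /\
     {ae P, forall w,
        x ^~ w @ \oo --> xstar w /\
        (fun k => ym k.+1 w) @ \oo --> xstar w /\
        z ^~ w @ \oo --> xstar w}).
Proof.
move=> zer _ _ _ L0 lipG rho0 mono _ s7 kap kappa1 Th0 eta1 eta2 eta3.
move=> sigF Fm _ adapt Tx0 init upy upv vT upz Dm0 delta0 eb1 eb2 sum_delta.
have adm := vfog_admissible _ _ _ s7 rho0 eta1 eta3.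
have ops : weak_minty_data G T L rho_n by split.
have eta0 := adm_eta _ _ _ _ adm.
have [q16 budget] := vfog_budget _ _ _ _ _ s7 kap kappa1 Th0 L0 eta0 eta2.
have contr := vfog_contraction _ _ s7 kap.
have kappa0 : 0 <= kappa.
  by apply: le_trans (ltW kap); rewrite divr_ge0 ?sqr_ge0//; lra.
(* Tested on the whole space, the conditional inequalities of (EB) become inequalities between total
   expectations. *)
have FT k : F k setT.
  by have [F0 FC _] := sigF k; rewrite -(setD0 setT); exact: FC.
have run o : vfog_path T s eta rho_n (x ^~ o) (v ^~ o) (z ^~ o) (ym ^~ o) (Gm ^~ o).
  split=> // -[|k] //=; have [-> [-> _]] := init o; exact: Tx0.
have ini : exists x0 v0, forall o,
  [/\ x 0%N o = x0, v 0%N o = v0, z 0%N o = x0, ym 0%N o = x0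
    & Gm 0%N o = G x0 /\ Dm 0%N o = 0].
  by exists x0, v0 => o; have [? [? [? [? [? ?]]]]] := init o.
have Fmeas_fun k f : Fmeas (F k) f -> measurable_fun setT f.
  by move=> Ff _ B mB; rewrite setTI; apply: Fm; exact: Ff.
have meas k : [/\ measurable_vec (x k), measurable_vec (v k),
    measurable_vec (z k), measurable_vec (Gm k) & measurable_fun setT (Dm k)].
  have [mx [mv [mz [mG mD]]]] := adapt k.
  split; last exact: Fmeas_fun mD.
  - by move=> i; exact: Fmeas_fun (mx i).
  - by move=> i; exact: Fmeas_fun (mv i).
  - by move=> i; exact: Fmeas_fun (mz i).
  - by move=> i; exact: Fmeas_fun (mG i).
have ae := ae_sums P G T L rho_n s eta kappa Theta delta x v z ym Gm Dm adm ops
  run ini meas Dm0 (fun k => eb1 k _ (FT k)) (fun k => eb2 k _ (FT k)) zer q16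
  kappa0 kappa1 Th0 delta0 sum_delta contr budget.
split; last split.
- move: ae; apply: filterS => o [c1 c2 c3]; split=> //.
  exact: (sum_lagged_resid G T L rho_n s eta (x ^~ o) (v ^~ o) (ym ^~ o) (Gm ^~ o) adm ops c1 c2 c3).
- move: ae; apply: filterS => o [c1 c2 c3]; split.
    exact: (sqr_resid_to0 G T L rho_n s eta (x ^~ o) (v ^~ o) (z ^~ o) (ym ^~ o) (Gm ^~ o) adm ops (run o) c1 c2 c3).
  exact: (sqr_lagged_resid_to0 G T L rho_n s eta (x ^~ o) (v ^~ o) (z ^~ o) (ym ^~ o) (Gm ^~ o) adm ops (run o) c1 c2 c3).
move=> clo; have [N [mN PN0 Nsub]] := ae; have [xs zx] := zer.
(* On the measurable null set [N] the limit is replaced by the fixed zero [xs], so that [xstar] is a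
   zero at every point and not only almost surely. *)
have /choice[xstar xstarP] : forall o, exists l, [/\ zerPhi G T l, N o -> l = xs &
    ~ N o -> [/\ x ^~ o @ \oo --> l, (fun k => ym k.+1 o) @ \oo --> l
              & z ^~ o @ \oo --> l]].
  move=> o; have [No|nNo] := pselect (N o); first by exists xs.
  have [c1 c2 c3] : [/\
      cvgn (series (fun k => (k%:R + 1) * nrm2 (resid G (x ^~ o) (v ^~ o) k))),
      cvgn (series (fun k => tk s k ^+ 2 * nrm2 (est_err G (ym ^~ o) (Gm ^~ o) k.+1))) &
      cvgn (series (fun k => tk s k ^+ 2 * nrm2 (x k.+1 o - ym k.+1 o)))].
    by apply: contrapT => h; exact/nNo/Nsub.
  have [l zl cl] := path_cvg _ _ _ _ _ _ _ _ _ _ _ adm ops (run o) c1 c2 c3 zer clo.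
  by exists l.
exists xstar; split; [move=> i|split].
(* Each coordinate of [xstar] is the pointwise limit of these measurable functions, which follow
   [x k] off [N] and are constant on [N]. *)
- pose h k o := \1_N o * xs ord0 i + \1_(~` N) o * x k o ord0 i : R.
  apply: (@measurable_fun_cvg _ _ _ setT h).
    have mNC : measurable (~` N) by exact: measurableC.
    move=> k; have [mx _ _ _ _] := meas k.
    apply: measurable_funD; apply: measurable_funM => //; exact: mx.
  move=> o _; have [_ inN notN] := xstarP o.
  have [No|nNo] := pselect (N o).
    rewrite (_ : h ^~ o = fun=> xs ord0 i); first by rewrite inN//; exact: cvg_cst.
    by apply/funext => k; rewrite /h !indicE mem_set// memNset ?mul1r ?mul0r ?addr0//; exact.
  rewrite (_ : h ^~ o = fun k => x k o ord0 i).
    have [xl _ _] := notN nNo.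
    exact: (cvg_comp _ _ xl (@coord_continuous _ _ _ ord0 i (xstar o))).
  by apply/funext => k; rewrite /h !indicE memNset// mem_set// mul1r mul0r add0r.
- by move=> o; case: (xstarP o).
- exists N; split=> // o /= h; apply: contrapT => nNo; apply: h.
  by have [_ _ /(_ nNo) []] := xstarP o.
Qed.
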